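(* Let $\mathfrak g$ be a Lie algebra. For any $\mathfrak g$-Hopf algebra $\mathcal F$ and any induced $(\mathfrak g,\mathcal F)$-module $M$, the right action and left coaction of $\mathcal F\blacktriangleright\!\!\triangleleft\,U(\mathfrak g)$ $$m\cdot(f\otimes u)=\varepsilon(f)\,\delta_{\mathfrak g}(u_{(1)})\,S(u_{(2)})m,\qquad m\mapsto\big(\sigma_{\mathcal F}S(m_{<1>})\otimes1\big)\otimes m_{<0>}$$ define a stable anti-Yetter–Drinfeld (SAYD) module structure over $\mathcal F\blacktriangleright\!\!\triangleleft\,U(\mathfrak g)$ on ${}^\sigma M_\delta:={}^\sigma\mathbb C_\delta\otimes M\;(\cong M$ as a vector space$)$, where $(\delta,\sigma)$ is the canonical modular pair in involution associated to $(\mathfrak g,\mathcal F)$.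
   Context: Everything is over $\mathbb C$; Lie algebras are finite dimensional. Sweedler notation $\Delta(h)=h_{(1)}\otimes h_{(2)}$, right coactions $u\mapsto u_{<0>}\otimes u_{<1>}$, left coactions $m\mapsto m_{<-1>}\otimes m_{<0>}$. **$\mathfrak g$-Hopf algebra.** A commutative Hopf algebra $\mathcal F$ on which $\mathfrak g$ acts by derivations ($X\triangleright f$) is a $\mathfrak g$-Hopf algebra if: (1) there is a right coaction $\blacktriangledown:\mathfrak g\to\mathfrak g\otimes\mathcal F$ satisfying the structure identity: for a basis $X_1,\dots,X_n$ of $\mathfrak g$ with $[X_i,X_j]=\sum_kC^k_{i,j}X_k$, writing $\blacktriangledown(X_j)=\sum_iX_i\otimes f^i_j$ and $f^i_{j,k}:=X_k\triangleright f^i_j$, one has $f^k_{j,i}-f^k_{i,j}=\sum_{s,r}C^k_{s,r}f^r_if^s_j+\sum_lC^l_{i,j}f^k_l$; (2) $\varepsilon(X\triangleright f)=0$ and $\Delta(X\triangleright f)=X_{<0>}\triangleright f_{(1)}\otimes X_{<1>}f_{(2)}+f_{(1)}\otimes X\triangleright f_{(2)}$. The coaction extends to $U(\mathfrak g)$ by $\blacktriangledown(1)=1\otimes1$, $\blacktriangledown(uv)=u_{(1)<0>}v_{<0>}\otimes u_{(1)<1>}(u_{(2)}\triangleright v_{<1>})$. **Bicrossed product.** $\mathcal F\blacktriangleright\!\!\triangleleft\,U(\mathfrak g)$ is the Hopf algebra on $\mathcal F\otimes U(\mathfrak g)$ with product $(f\otimes u)(g\otimes v)=f(u_{(1)}\triangleright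 g)\otimes u_{(2)}v$, coproduct $\Delta(f\otimes u)=f_{(1)}\otimes u_{(1)<0>}\otimes f_{(2)}u_{(1)<1>}\otimes u_{(2)}$, unit $1\otimes1$, counit $\varepsilon\otimes\varepsilon$, antipode $S(f\otimes u)=(1\otimes S(u_{<0>}))(S(fu_{<1>})\otimes1)$. **Canonical modular pair.** $\delta_{\mathfrak g}(X)=\mathrm{Tr}(\mathrm{ad}_X)$ extended to an algebra map $U(\mathfrak g)\to\mathbb C$, $\delta(f\otimes u)=\varepsilon(f)\delta_{\mathfrak g}(u)$; $\sigma_{\mathcal F}=\det[f^i_j]\in\mathcal F$, $\sigma=\sigma_{\mathcal F}\otimes1$. ${}^\sigma\mathbb C_\delta$ is $\mathbb C$ with right action via $\delta$ and left coaction $1\mapsto\sigma\otimes1$. **Induced module.** A left $\mathfrak g$-module and right $\mathcal F$-comodule $M$ is an induced $(\mathfrak g,\mathcal F)$-module if its coaction $\blacktriangledown_M(m)=m_{<0>}\otimes m_{<1>}$ satisfies $\blacktriangledown_M(X\cdot m)=X_{<0>}\cdot m_{<0>}\otimes X_{<1>}m_{<1>}+m_{<0>}\otimes X\triangleright m_{<1>}$ for $X\in\mathfrak g$, $m\in M$. **SAYD module.** A right module and left comodule $N$ over a Hopf algebra $\mathcal H$ is (right-left) stable anti-Yetter–Drinfeld if for all $n\in N$, $h\in\mathcal H$: $\blacktriangledown(n\cdot h)=S(h_{(3)})n_{<-1>}h_{(1)}\otimes n_{<0>}\cdot h_{(2)}$ and $n_{<0>}\cdot n_{<-1>}=n$.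 *)

(* Defs.v *)
From HB Require Import structures.
From mathcomp Require Import all_boot all_order all_algebra.
From mathcomp Require Import boolp reals complex.

Set Implicit Arguments.
Unset Strict Implicit.
Unset Printing Implicit Defensive.

Import GRing.Theory.

Local Open Scope ring_scope.
Local Open Scope quotient_scope.

Definition bilin (K : fieldType) (U V W : lmodType K) (f : U -> V -> W) : Prop :=
  (forall v, linear (f^~ v)) /\ (forall u, linear (f u)).

Section Tensor.
Variables (K : fieldType) (V W : lmodType K).

(* A formal sum of pure tensors is a list of pairs; [tens_rel] is the least
   congruence for concatenation that makes it commutative and the pairing
   K-bilinear. *)
Inductive tens_rel : seq (V * W) -> seq (V * W) -> Prop :=
| tr_refl s : tens_rel s s
| tr_sym s t : tens_rel s t -> tens_rel t s
| tr_trans s t u : tens_rel s t -> tens_rel t u -> tens_rel s u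
| tr_cat s s' t t' : tens_rel s s' -> tens_rel t t' ->
    tens_rel (s ++ t) (s' ++ t')
| tr_comm s t : tens_rel (s ++ t) (t ++ s)
| tr_addl v v' w : tens_rel [:: (v + v', w)] [:: (v, w); (v', w)]
| tr_addr v w w' : tens_rel [:: (v, w + w')] [:: (v, w); (v, w')]
| tr_scale a v w : tens_rel [:: (a *: v, w)] [:: (v, a *: w)]
| tr_zero w : tens_rel [:: (0, w)] [::].

Definition tens_eqb : rel (seq (V * W)) := fun s t => `[< tens_rel s t >].

Lemma tens_eqb_refl : reflexive tens_eqb.
Proof. by move=> s; apply/asboolP; exact: tr_refl. Qed.

Lemma tens_eqb_sym : symmetric tens_eqb.
Proof. by move=> s t; apply/asboolP/asboolP => /tr_sym. Qed.

Lemma tens_eqb_trans : transitive tens_eqb.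
Proof.
by move=> t s u /asboolP st /asboolP tu; apply/asboolP; exact: tr_trans tu.
Qed.

Canonical tens_equiv := EquivRel tens_eqb tens_eqb_refl tens_eqb_sym tens_eqb_trans.

Definition tensor := {eq_quot tens_equiv}.

HB.instance Definition _ := Choice.on tensor.

Definition tpi (s : seq (V * W)) : tensor := \pi s.

Definition trepr (t : tensor) : seq (V * W) := repr t.

Lemma treprK : cancel trepr tpi.
Proof. by move=> t; rewrite /tpi /trepr reprK. Qed.

Lemma tpiP s t : tens_rel s t <-> tpi s = tpi t.
Proof.
split=> [st|/eqP].
- by apply/eqmodP => /=; apply/asboolP.
- by move/eqP/eqmodP => /asboolP.
Qed.

Lemma trepr_pi s : tens_rel (trepr (tpi s)) s.
Proof. by apply/tpiP; rewrite treprK. Qed.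

Definition tens (v : V) (w : W) : tensor := tpi [:: (v, w)].

Let sc (a : K) (p : V * W) := (a *: p.1, p.2).

Definition tens_zero : tensor := tpi [::].
Definition tens_add (t u : tensor) : tensor := tpi (trepr t ++ trepr u).
Definition tens_scale (a : K) (t : tensor) : tensor := tpi (map (sc a) (trepr t)).
Definition tens_opp (t : tensor) : tensor := tens_scale (-1) t.

Lemma tpi_cat s t : tens_add (tpi s) (tpi t) = tpi (s ++ t).
Proof. by apply/tpiP; apply: tr_cat; exact: trepr_pi. Qed.

Lemma tens_rel_scale a s t :
  tens_rel s t -> tens_rel (map (sc a) s) (map (sc a) t).
Proof.
elim=> {s t}.
- by move=> s; exact: tr_refl.
- by move=> s t _; exact: tr_sym.
- by move=> s t u _ st _ tu; exact: tr_trans tu.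
- by move=> s s' t t' _ ss _ tt; rewrite !map_cat; exact: tr_cat.
- by move=> s t; rewrite !map_cat; exact: tr_comm.
- by move=> v v' w; rewrite /= /sc /= scalerDr; exact: tr_addl.
- by move=> v w w'; exact: tr_addr.
- by move=> b v w; rewrite /= /sc /= scalerA mulrC -scalerA; exact: tr_scale.
- by move=> w; rewrite /= /sc /= scaler0; exact: tr_zero.
Qed.

Lemma tpi_scale a s : tens_scale a (tpi s) = tpi (map (sc a) s).
Proof. by apply/tpiP; apply: tens_rel_scale; exact: trepr_pi. Qed.

Lemma tens_addA : associative tens_add.
Proof.
move=> s t u; rewrite -(treprK s) -(treprK t) -(treprK u).
by rewrite !tpi_cat catA.
Qed.

Lemma tens_addC : commutative tens_add.
Proof. by move=> s t; apply/tpiP; exact: tr_comm. Qed.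

Lemma tens_add0 : left_id tens_zero tens_add.
Proof. by move=> t; rewrite -(treprK t) tpi_cat. Qed.

Lemma tens_rel_scaleD a b s :
  tens_rel (map (sc (a + b)) s) (map (sc a) s ++ map (sc b) s).
Proof.
elim: s => [|[v w] s IH] /=; first exact: tr_refl.
apply: (@tr_trans _ ([:: sc a (v, w); sc b (v, w)] ++ (map (sc a) s ++ map (sc b) s))).
  rewrite -cat1s; apply: tr_cat => //; rewrite /sc /= scalerDl; exact: tr_addl.
change (tens_rel ([:: sc a (v, w)] ++ (([:: sc b (v, w)] ++ map (sc a) s) ++ map (sc b) s))
  ([:: sc a (v, w)] ++ (map (sc a) s ++ ([:: sc b (v, w)] ++ map (sc b) s)))).
apply: tr_cat; first exact: tr_refl.
rewrite [X in tens_rel _ X]catA; apply: tr_cat; last exact: tr_refl.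
exact: tr_comm.
Qed.

Lemma tens_rel_scale0 s : tens_rel (map (sc 0) s) [::].
Proof.
elim: s => [|[v w] s IH] /=; first exact: tr_refl.
rewrite -cat1s -[X in tens_rel _ X](cats0 [::]); apply: tr_cat => //.
by rewrite /sc /= scale0r; exact: tr_zero.
Qed.

Lemma map_sc1 s : map (sc 1) s = s.
Proof. by rewrite -[RHS]map_id; apply: eq_map => -[v w]; rewrite /sc /= scale1r. Qed.

Lemma tens_addN : left_inverse tens_zero tens_opp tens_add.
Proof.
move=> t; rewrite -(treprK t) /tens_opp tpi_scale tpi_cat; apply/tpiP.
rewrite -{2}(map_sc1 (trepr t)); apply: tr_trans (tr_sym (tens_rel_scaleD _ _ _)) _.
by rewrite addNr; exact: tens_rel_scale0.
Qed.

HB.instance Definition _ :=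
  GRing.isZmodule.Build tensor tens_addA tens_addC tens_add0 tens_addN.

Lemma tens_scaleA a b t : tens_scale a (tens_scale b t) = tens_scale (a * b) t.
Proof.
rewrite -(treprK t) !tpi_scale -map_comp; congr tpi; apply: eq_map => -[v w].
by rewrite /sc /= scalerA.
Qed.

Lemma tens_scale1 : left_id 1 tens_scale.
Proof. by move=> t; rewrite -(treprK t) tpi_scale map_sc1. Qed.

Lemma tens_scaleDr : right_distributive tens_scale +%R.
Proof.
move=> a s t; rewrite -(treprK s) -(treprK t) /GRing.add /=.
by rewrite !(tpi_cat, tpi_scale) map_cat.
Qed.

Lemma tens_scaleDl t : {morph tens_scale^~ t : a b / a + b}.
Proof.
move=> a b; rewrite -(treprK t) [in RHS]/GRing.add /=.
by rewrite !tpi_scale tpi_cat; apply/tpiP; exact: tens_rel_scaleD.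
Qed.

HB.instance Definition _ := GRing.Zmodule_isLmodule.Build K tensor
  tens_scaleA tens_scale1 tens_scaleDr tens_scaleDl.

Lemma tens_bilin : bilin tens.
Proof.
have al w v v' : tens (v + v') w = tens v w + tens v' w.
  by rewrite [RHS]/GRing.add /= tpi_cat; apply/tpiP; exact: tr_addl.
have ar v w w' : tens v (w + w') = tens v w + tens v w'.
  by rewrite [RHS]/GRing.add /= tpi_cat; apply/tpiP; exact: tr_addr.
have sl a v w : tens (a *: v) w = a *: tens v w.
  by rewrite [RHS]/GRing.scale /= tpi_scale.
have sr a v w : tens v (a *: w) = a *: tens v w.
  by rewrite -sl; apply/tpiP; apply/tr_sym; exact: tr_scale.
by split=> [w a v v'|v a w w']; rewrite ?al ?ar ?sl ?sr.
Qed.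

Lemma tpi_sum s : tpi s = \sum_(p <- s) tens p.1 p.2.
Proof.
elim: s => [|[v w] s IH]; first by rewrite big_nil.
by rewrite big_cons -IH [RHS]/GRing.add /= tpi_cat.
Qed.

(* Sweedler sums: [tsum t f] is the sum of [f v w] over a decomposition
   [t = sum v (x) w]; for bilinear [f] it does not depend on the decomposition
   (lemma [tsum_tens]). *)
Definition tsum (Z : lmodType K) (t : tensor) (f : V -> W -> Z) : Z :=
  \sum_(p <- trepr t) f p.1 p.2.

Lemma tens_rel_sum (Z : lmodType K) (f : V -> W -> Z) s t : bilin f ->
  tens_rel s t -> \sum_(p <- s) f p.1 p.2 = \sum_(p <- t) f p.1 p.2.
Proof.
move=> [fl fr]; elim=> {s t} //.
- by move=> s t u _ -> _ ->.
- by move=> s s' t t' _ e _ e'; rewrite !big_cat /= e e'.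
- by move=> s t; rewrite !big_cat /= addrC.
- move=> v v' w; rewrite !big_cons !big_nil /= !addr0.
  by have := fl w 1 v v'; rewrite !scale1r.
- move=> v w w'; rewrite !big_cons !big_nil /= !addr0.
  by have := fr v 1 w w'; rewrite !scale1r.
- move=> a v w; rewrite !big_seq1 /=.
  have f0l : f 0 w = 0.
    by have := fl w (-1) 0 0; rewrite scaler0 addr0 scaleN1r addNr.
  have f0r : f v 0 = 0.
    by have := fr v (-1) 0 0; rewrite scaler0 addr0 scaleN1r addNr.
  have := fl w a v 0; have := fr v a w 0.
  by rewrite !addr0 f0l f0r !addr0 => -> ->.
- move=> w; rewrite big_seq1 big_nil /=.
  by have := fl w (-1) 0 0; rewrite scaler0 addr0 scaleN1r addNr.
Qed.

Lemma tsum_pi (Z : lmodType K) (f : V -> W -> Z) s : bilin f ->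
  tsum (tpi s) f = \sum_(p <- s) f p.1 p.2.
Proof. by move=> bf; apply: tens_rel_sum => //; exact: trepr_pi. Qed.

Lemma tsum_tens (Z : lmodType K) (f : V -> W -> Z) v w : bilin f ->
  tsum (tens v w) f = f v w.
Proof. by move=> bf; rewrite tsum_pi // big_seq1. Qed.

Lemma tsum_linear (Z : lmodType K) (f : V -> W -> Z) : bilin f ->
  linear (fun t => tsum t f).
Proof.
move=> bf a s t; rewrite -(treprK s) -(treprK t).
rewrite [a *: _]/GRing.scale /= tpi_scale [X in tsum X]/GRing.add /= tpi_cat.
rewrite !tsum_pi // big_cat /= big_map scaler_sumr; congr (_ + _).
apply: eq_bigr => -[v w] _ /=.
have f0l : f 0 w = 0.
  by have := bf.1 w (-1) 0 0; rewrite scaler0 addr0 scaleN1r addNr.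
by have := bf.1 w a v 0; rewrite !addr0 f0l addr0.
Qed.

Lemma tens_sumE t : t = tsum t tens.
Proof. by rewrite /tsum -tpi_sum treprK. Qed.

Lemma tens_ind (P : tensor -> Prop) :
  P 0 -> (forall t u, P t -> P u -> P (t + u)) ->
  (forall v w, P (tens v w)) -> forall t, P t.
Proof.
move=> P0 PD PT t; rewrite (tens_sumE t) /tsum.
by apply: big_ind => // p _; exact: PT.
Qed.

End Tensor.

Notation "V ⊗ W" := (@tensor _ V%type W%type)
  (at level 45, left associativity) : type_scope.
Notation "v ⊗ w" := (tens v w) (at level 45, left associativity) : ring_scope.
Notation "\tsum_ ( v , w <- t ) E" := (tsum t (fun v w => E))
  (at level 46, E at level 46, t at level 200, v name, w name,
   format "'[' \tsum_ ( v ,  w  <-  t ) '/  '  E ']'") : ring_scope.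

Section LinearFacts.
Variables (K : fieldType) (V W : lmodType K) (f : V -> W).
Hypothesis lf : linear f.

Lemma lin0 : f 0 = 0.
Proof. by have := lf (-1) 0 0; rewrite scaler0 addr0 scaleN1r addNr. Qed.

Lemma linD u v : f (u + v) = f u + f v.
Proof. by have := lf 1 u v; rewrite !scale1r. Qed.

Lemma linZ a u : f (a *: u) = a *: f u.
Proof. by have := lf a u 0; rewrite lin0 !addr0. Qed.

Lemma linN u : f (- u) = - f u.
Proof. by rewrite -scaleN1r linZ scaleN1r. Qed.

Lemma lin_sum I (r : seq I) (P : pred I) (F : I -> V) :
  f (\sum_(i <- r | P i) F i) = \sum_(i <- r | P i) f (F i).
Proof. exact: (big_morph f linD lin0). Qed.

End LinearFacts.

Section TensorFacts.
Variables (K : fieldType) (V W Z : lmodType K).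
Implicit Types (v : V) (w : W) (t : V ⊗ W).

Lemma tensDl v v' w : (v + v') ⊗ w = v ⊗ w + v' ⊗ w.
Proof. exact: (linD ((tens_bilin V W).1 w)). Qed.

Lemma tensDr v w w' : v ⊗ (w + w') = v ⊗ w + v ⊗ w'.
Proof. exact: (linD ((tens_bilin V W).2 v)). Qed.

Lemma tensZl a v w : (a *: v) ⊗ w = a *: (v ⊗ w).
Proof. exact: (linZ ((tens_bilin V W).1 w)). Qed.

Lemma tensZr a v w : v ⊗ (a *: w) = a *: (v ⊗ w).
Proof. exact: (linZ ((tens_bilin V W).2 v)). Qed.

Lemma lin_tens_ext (f h : V ⊗ W -> Z) : linear f -> linear h ->
  (forall v w, f (v ⊗ w) = h (v ⊗ w)) -> f =1 h.
Proof.
move=> lf lh e; elim/tens_ind => //; first by rewrite (lin0 lf) (lin0 lh).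
by move=> t u et eu; rewrite (linD lf) (linD lh) et eu.
Qed.

Lemma tsumD t (f h : V -> W -> Z) :
  tsum t (fun v w => f v w + h v w) = tsum t f + tsum t h.
Proof. exact: big_split. Qed.

Lemma tsumZ a t (f : V -> W -> Z) :
  tsum t (fun v w => a *: f v w) = a *: tsum t f.
Proof. by rewrite /tsum scaler_sumr. Qed.

Lemma tsum_eq t (f h : V -> W -> Z) :
  (forall v w, f v w = h v w) -> tsum t f = tsum t h.
Proof. by move=> e; apply: eq_bigr. Qed.

Lemma tsum_linear_param (Y : lmodType K) (f : Y -> V -> W -> Z) t :
  (forall v w, linear (fun y => f y v w)) -> linear (fun y => tsum t (f y)).
Proof. by move=> lf a y z; rewrite -tsumZ -tsumD; apply: tsum_eq => v w; exact: lf. Qed.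

Lemma lin_tsum (Y : lmodType K) (f : Z -> Y) (h : V -> W -> Z) t :
  linear f -> f (tsum t h) = tsum t (fun v w => f (h v w)).
Proof. by move=> lf; rewrite /tsum (lin_sum lf). Qed.

End TensorFacts.

Ltac lin_expand := rewrite ?(tensDl, tensDr, tensZl, tensZr, mulrDl, mulrDr,
  scalerDr, opprD, scalerN, =^~ scalerAl, =^~ scalerAr).

HB.mixin Record Vector_isLie (K : fieldType) g of Vector K g := {
  lie_bracket : g -> g -> g;
  lie_bracket_bilin : bilin lie_bracket;
  lie_bracketxx : forall x, lie_bracket x x = 0;
  lie_jacobi : forall x y z, lie_bracket x (lie_bracket y z)
    + lie_bracket y (lie_bracket z x) + lie_bracket z (lie_bracket x y) = 0
}.

#[short(type="lieAlgType")]
HB.structure Definition LieAlgebra (K : fieldType) :=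
  { g of Vector_isLie K g & Vector K g }.

Notation "[[ x , y ]]" := (lie_bracket x y) (at level 0, x, y at level 200) : ring_scope.

Definition lie_module (K : fieldType) (g : lieAlgType K) (M : lmodType K)
    (rho : g -> M -> M) : Prop :=
  bilin rho /\
  forall x y m, rho [[x, y]] m = rho x (rho y m) - rho y (rho x m).

Section Enveloping.
Variables (K : fieldType) (g : lieAlgType K).

Inductive uexpr : Type :=
| UGen of g
| UScal of K
| UAdd of uexpr & uexpr
| UMul of uexpr & uexpr.

HB.instance Definition _ := gen_eqMixin uexpr.
HB.instance Definition _ := gen_choiceMixin uexpr.

(* The congruence presenting U(g): the axioms of a unital associative
   K-algebra, linearity of the generators, and xy - yx = [x, y]. *)
Inductive urel : uexpr -> uexpr -> Prop :=
| ur_refl a : urel a a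
| ur_sym a b : urel a b -> urel b a
| ur_trans a b c : urel a b -> urel b c -> urel a c
| ur_add a a' b b' : urel a a' -> urel b b' -> urel (UAdd a b) (UAdd a' b')
| ur_mul a a' b b' : urel a a' -> urel b b' -> urel (UMul a b) (UMul a' b')
| ur_addA a b c : urel (UAdd a (UAdd b c)) (UAdd (UAdd a b) c)
| ur_addC a b : urel (UAdd a b) (UAdd b a)
| ur_add0 a : urel (UAdd (UScal 0) a) a
| ur_mulA a b c : urel (UMul a (UMul b c)) (UMul (UMul a b) c)
| ur_mul1l a : urel (UMul (UScal 1) a) a
| ur_mul1r a : urel (UMul a (UScal 1)) a
| ur_mul0 a : urel (UMul (UScal 0) a) (UScal 0)
| ur_mulDl a b c : urel (UMul (UAdd a b) c) (UAdd (UMul a c) (UMul b c))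
| ur_mulDr a b c : urel (UMul a (UAdd b c)) (UAdd (UMul a b) (UMul a c))
| ur_scalD k l : urel (UScal (k + l)) (UAdd (UScal k) (UScal l))
| ur_scalM k l : urel (UScal (k * l)) (UMul (UScal k) (UScal l))
| ur_scalC k a : urel (UMul (UScal k) a) (UMul a (UScal k))
| ur_genL k x y :
    urel (UGen (k *: x + y)) (UAdd (UMul (UScal k) (UGen x)) (UGen y))
| ur_lie x y : urel (UGen [[x, y]])
    (UAdd (UMul (UGen x) (UGen y))
          (UMul (UScal (-1)) (UMul (UGen y) (UGen x)))).

Definition ueqb : rel uexpr := fun a b => `[< urel a b >].

Lemma ueqb_refl : reflexive ueqb.
Proof. by move=> a; apply/asboolP; exact: ur_refl. Qed.

Lemma ueqb_sym : symmetric ueqb.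
Proof. by move=> a b; apply/asboolP/asboolP => /ur_sym. Qed.

Lemma ueqb_trans : transitive ueqb.
Proof.
by move=> b a c /asboolP ab /asboolP bc; apply/asboolP; exact: ur_trans bc.
Qed.

Canonical uequiv := EquivRel ueqb ueqb_refl ueqb_sym ueqb_trans.

Definition envalg := {eq_quot uequiv}.

HB.instance Definition _ := Choice.on envalg.

Definition upi (a : uexpr) : envalg := \pi a.
Definition urepr (u : envalg) : uexpr := repr u.

Lemma ureprK : cancel urepr upi.
Proof. by move=> u; rewrite /upi /urepr reprK. Qed.

Lemma upiP a b : urel a b <-> upi a = upi b.
Proof.
split=> [ab|/eqP].
- by apply/eqmodP => /=; apply/asboolP.
- by move/eqP/eqmodP => /asboolP.
Qed.

Lemma urepr_pi a : urel (urepr (upi a)) a.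
Proof. by apply/upiP; rewrite ureprK. Qed.

Fixpoint ueval (M : lmodType K) (rho : g -> M -> M) (a : uexpr) (m : M) : M :=
  match a with
  | UGen x => rho x m
  | UScal k => k *: m
  | UAdd a b => ueval rho a m + ueval rho b m
  | UMul a b => ueval rho a (ueval rho b m)
  end.

Lemma ueval_linear (M : lmodType K) (rho : g -> M -> M) a :
  bilin rho -> linear (ueval rho a).
Proof.
move=> [_ rr]; elim: a => [x|k|a IHa b IHb|a IHa b IHb] c m n /=.
- exact: rr.
- by rewrite scalerDr !scalerA mulrC.
- by rewrite IHa IHb scalerDr addrACA.
- by rewrite IHb IHa.
Qed.

Lemma ueval_rel (M : lmodType K) (rho : g -> M -> M) a b : lie_module rho ->
  urel a b -> forall m, ueval rho a m = ueval rho b m.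
Proof.
move=> [br lr]; elim=> {a b} //=.
- by move=> a b c _ ab _ bc m; rewrite ab.
- by move=> a a' b b' _ aa _ bb m; rewrite aa bb.
- by move=> a a' b b' _ aa _ bb m; rewrite bb aa.
- by move=> *; rewrite addrA.
- by move=> *; rewrite addrC.
- by move=> *; rewrite scale0r add0r.
- by move=> *; rewrite scale1r.
- by move=> *; rewrite scale1r.
- by move=> *; rewrite !scale0r.
- move=> a b c m; have := ueval_linear a br 1.
  by move/(_ (ueval rho b m) (ueval rho c m)); rewrite !scale1r.
- by move=> *; rewrite scalerDl.
- by move=> *; rewrite scalerA.
- move=> k a m; have f0 : ueval rho a 0 = 0.
    have := ueval_linear a br (-1) 0 0.
    by rewrite scaler0 addr0 scaleN1r addNr.
  by have := ueval_linear a br k m 0; rewrite !addr0 f0 addr0.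
- by move=> k x y m; rewrite br.1.
- by move=> x y m; rewrite lr scaleN1r.
Qed.

Definition uzero : envalg := upi (UScal 0).
Definition uone : envalg := upi (UScal 1).
Definition uadd (u v : envalg) := upi (UAdd (urepr u) (urepr v)).
Definition umul (u v : envalg) := upi (UMul (urepr u) (urepr v)).
Definition uscale (k : K) (u : envalg) := upi (UMul (UScal k) (urepr u)).
Definition uopp (u : envalg) := uscale (-1) u.

Lemma upiD a b : uadd (upi a) (upi b) = upi (UAdd a b).
Proof. by apply/upiP; apply: ur_add; exact: urepr_pi. Qed.

Lemma upiM a b : umul (upi a) (upi b) = upi (UMul a b).
Proof. by apply/upiP; apply: ur_mul; exact: urepr_pi. Qed.

Lemma upiZ k a : uscale k (upi a) = upi (UMul (UScal k) a).
Proof.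
by apply/upiP; apply: ur_mul; [exact: ur_refl|exact: urepr_pi].
Qed.

Lemma uaddA : associative uadd.
Proof.
move=> s t u; rewrite -(ureprK s) -(ureprK t) -(ureprK u) !upiD.
by apply/upiP; exact: ur_addA.
Qed.

Lemma uaddC : commutative uadd.
Proof. by move=> s t; apply/upiP; exact: ur_addC. Qed.

Lemma uadd0 : left_id uzero uadd.
Proof. by move=> t; rewrite -(ureprK t) upiD; apply/upiP; exact: ur_add0. Qed.

Lemma uaddN : left_inverse uzero uopp uadd.
Proof.
move=> t; rewrite -(ureprK t) /uopp upiZ upiD; apply/upiP; move: (urepr t) => a.
apply: (@ur_trans _ (UAdd (UMul (UScal (-1)) a) (UMul (UScal 1) a))).
  by apply: ur_add; [exact: ur_refl|apply: ur_sym; exact: ur_mul1l].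
apply: ur_trans (ur_sym (ur_mulDl _ _ _)) _.
apply: (@ur_trans _ (UMul (UScal 0) a)); last exact: ur_mul0.
apply: ur_mul; last exact: ur_refl.
by apply: ur_sym; rewrite -(addNr 1); exact: ur_scalD.
Qed.

HB.instance Definition _ :=
  GRing.isZmodule.Build envalg uaddA uaddC uadd0 uaddN.

Lemma umulA : associative umul.
Proof.
move=> s t u; rewrite -(ureprK s) -(ureprK t) -(ureprK u) !upiM.
by apply/upiP; exact: ur_mulA.
Qed.

Lemma umul1l : left_id uone umul.
Proof. by move=> t; rewrite -(ureprK t) upiM; apply/upiP; exact: ur_mul1l. Qed.

Lemma umul1r : right_id uone umul.
Proof. by move=> t; rewrite -(ureprK t) upiM; apply/upiP; exact: ur_mul1r. Qed.

Lemma umulDl : left_distributive umul +%R.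
Proof.
move=> s t u; rewrite -(ureprK s) -(ureprK t) -(ureprK u) /GRing.add /=.
by rewrite !(upiD, upiM); apply/upiP; exact: ur_mulDl.
Qed.

Lemma umulDr : right_distributive umul +%R.
Proof.
move=> s t u; rewrite -(ureprK s) -(ureprK t) -(ureprK u) /GRing.add /=.
by rewrite !(upiD, upiM); apply/upiP; exact: ur_mulDr.
Qed.

Lemma uone_neq0 : uone != 0.
Proof.
apply/eqP => /upiP rel01.
have triv : @lie_module K g K^o (fun _ _ => 0).
  by split; [split=> ? ? ? ?; rewrite scaler0 addr0|move=> ? ? ?; rewrite subr0].
have := ueval_rel triv rel01 1; rewrite /= scale1r scale0r => /eqP.
by rewrite oner_eq0.
Qed.

HB.instance Definition _ := GRing.Zmodule_isNzRing.Build envalg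
  umulA umul1l umul1r umulDl umulDr uone_neq0.

Lemma uscaleA k l u : uscale k (uscale l u) = uscale (k * l) u.
Proof.
rewrite -(ureprK u) !upiZ; apply/upiP; apply: ur_trans (ur_mulA _ _ _) _.
by apply: ur_mul; [apply: ur_sym; exact: ur_scalM|exact: ur_refl].
Qed.

Lemma uscale1 : left_id 1 uscale.
Proof. by move=> u; rewrite -(ureprK u) upiZ; apply/upiP; exact: ur_mul1l. Qed.

Lemma uscaleDr : right_distributive uscale +%R.
Proof.
move=> k s t; rewrite -(ureprK s) -(ureprK t) /GRing.add /=.
by rewrite !(upiD, upiZ); apply/upiP; exact: ur_mulDr.
Qed.

Lemma uscaleDl u : {morph uscale^~ u : a b / a + b}.
Proof.
move=> k l; rewrite -(ureprK u) [in RHS]/GRing.add /=.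
rewrite !upiZ upiD; apply/upiP; apply: ur_trans (ur_mulDl _ _ _).
by apply: ur_mul; [exact: ur_scalD|exact: ur_refl].
Qed.

HB.instance Definition _ := GRing.Zmodule_isLmodule.Build K envalg
  uscaleA uscale1 uscaleDr uscaleDl.

Lemma uscaleAl k (u v : envalg) : k *: (u * v) = (k *: u) * v.
Proof.
rewrite -(ureprK u) -(ureprK v) /GRing.mul /GRing.scale /=.
by rewrite !(upiZ, upiM); apply/upiP; exact: ur_mulA.
Qed.

HB.instance Definition _ := GRing.Lmodule_isLalgebra.Build K envalg uscaleAl.

Lemma uscaleAr k (u v : envalg) : k *: (u * v) = u * (k *: v).
Proof.
rewrite -(ureprK u) -(ureprK v) /GRing.mul /GRing.scale /=.
rewrite !(upiZ, upiM); apply/upiP; apply: ur_trans (ur_mulA _ _ _) _.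
apply: ur_trans (ur_sym (ur_mulA _ _ _)).
by apply: ur_mul; [exact: ur_scalC|exact: ur_refl].
Qed.

HB.instance Definition _ := GRing.Lalgebra_isAlgebra.Build K envalg uscaleAr.

Definition uiota (x : g) : envalg := upi (UGen x).

Lemma uiota_linear : linear uiota.
Proof.
move=> k x y.
have -> : k *: uiota x + uiota y = uadd (uscale k (uiota x)) (uiota y) by [].
by rewrite upiZ upiD; apply/upiP; exact: ur_genL.
Qed.

Lemma uiota_bracket x y : uiota [[x, y]] = uiota x * uiota y - uiota y * uiota x.
Proof.
have -> : uiota x * uiota y - uiota y * uiota x =
  uadd (umul (uiota x) (uiota y)) (uscale (-1) (umul (uiota y) (uiota x))) by [].
by rewrite !upiM upiZ upiD; apply/upiP; exact: ur_lie.
Qed.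

Lemma envalg_ind (P : envalg -> Prop) :
  P 1 -> (forall k u, P u -> P (k *: u)) -> (forall u v, P u -> P v -> P (u + v)) ->
  (forall x u, P u -> P (uiota x * u)) -> forall u, P u.
Proof.
move=> P1 PZ PD PM u; suff H a : forall v, P v -> P (upi a * v).
  by rewrite -(mulr1 u) -(ureprK u); exact: H.
elim: a => [x|k|a IHa b IHb|a IHa b IHb] v Pv.
- exact: PM.
- have -> : upi (UScal k) = k *: 1.
    rewrite -[RHS]/(uscale k (upi (UScal 1))) upiZ; apply/upiP; apply: ur_sym; exact: ur_mul1r.
  by rewrite -scalerAl mul1r; exact: PZ.
- have -> : upi (UAdd a b) = upi a + upi b by rewrite -upiD.
  by rewrite mulrDl; apply: PD; [exact: IHa|exact: IHb].
- have -> : upi (UMul a b) = upi a * upi b by rewrite -upiM.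
  by rewrite -mulrA; apply: IHa; exact: IHb.
Qed.

(* Meaningful when [lie_module rho]: it does not then depend on the chosen
   expression ([ueval_rel]) and it is the U(g)-module structure extending [rho]
   ([uact_gen], [uactM]). *)
Definition uact (M : lmodType K) (rho : g -> M -> M) (u : envalg) (m : M) : M :=
  ueval rho (urepr u) m.

End Enveloping.

Section EnvelopingFacts.
Variables (K : fieldType) (g : lieAlgType K).
Local Notation U := (envalg g).

Section Action.
Variables (M : lmodType K) (rho : g -> M -> M).
Hypothesis lm : lie_module rho.

Lemma uact_pi a m : uact rho (upi a) m = ueval rho a m.
Proof. by apply: ueval_rel => //; exact: urepr_pi. Qed.

Lemma uact1 m : uact rho 1 m = m.
Proof. by rewrite uact_pi /= scale1r. Qed.

Lemma uact_gen x m : uact rho (uiota x) m = rho x m.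
Proof. by rewrite uact_pi. Qed.

Lemma uactM u v m : uact rho (u * v) m = uact rho u (uact rho v m).
Proof. by rewrite -(ureprK u) -(ureprK v) -[_ * _]/(umul _ _) upiM !uact_pi. Qed.

Lemma uact_bilin : bilin (uact rho).
Proof.
split=> [m k u v|u]; last first.
  by rewrite -(ureprK u); apply: ueval_linear; case: lm.
rewrite -(ureprK u) -(ureprK v).
have -> : k *: upi (urepr u) + upi (urepr v) =
  uadd (uscale k (upi (urepr u))) (upi (urepr v)) by [].
by rewrite upiZ upiD !uact_pi.
Qed.

End Action.

End EnvelopingFacts.

HB.mixin Record Algebra_isHopf (K : fieldType) H of GRing.Algebra K H := {
  comul : H -> H ⊗ H;
  counit : H -> K;
  antipode : H -> H;
  comul_linear : linear comul;
  counit_scalar : scalar counit;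
  antipode_linear : linear antipode;
  comul_assoc : forall h,
    \tsum_(h1, h2 <- comul h) \tsum_(h11, h12 <- comul h1) h11 ⊗ (h12 ⊗ h2)
    = \tsum_(h1, h2 <- comul h) h1 ⊗ comul h2;
  comul_counitl : forall h, \tsum_(h1, h2 <- comul h) counit h1 *: h2 = h;
  comul_counitr : forall h, \tsum_(h1, h2 <- comul h) counit h2 *: h1 = h;
  comul1 : comul 1 = 1 ⊗ 1;
  comulM : forall h k, comul (h * k) =
    \tsum_(h1, h2 <- comul h) \tsum_(k1, k2 <- comul k) h1 * k1 ⊗ h2 * k2;
  counit1 : counit 1 = 1;
  counitM : forall h k, counit (h * k) = counit h * counit k;
  antipodel : forall h,
    \tsum_(h1, h2 <- comul h) antipode h1 * h2 = (counit h)%:A;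
  antipoder : forall h,
    \tsum_(h1, h2 <- comul h) h1 * antipode h2 = (counit h)%:A
}.

#[short(type="hopfAlgType")]
HB.structure Definition HopfAlgebra (K : fieldType) :=
  { H of Algebra_isHopf K H & GRing.Algebra K H }.

#[short(type="comHopfAlgType")]
HB.structure Definition ComHopfAlgebra (K : fieldType) :=
  { H of Algebra_isHopf K H & GRing.ComAlgebra K H }.

Definition right_comodule (K : fieldType) (H : hopfAlgType K) (M : lmodType K)
    (rho : M -> M ⊗ H) : Prop :=
  [/\ linear rho,
      forall m, \tsum_(m0, m1 <- rho m) \tsum_(m00, m01 <- rho m0) m00 ⊗ (m01 ⊗ m1)
                = \tsum_(m0, m1 <- rho m) m0 ⊗ comul m1
    & forall m, \tsum_(m0, m1 <- rho m) counit m1 *: m0 = m].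

Section HopfEnveloping.
Variables (K : fieldType) (g : lieAlgType K).
Local Notation U := (envalg g).

(* The structure maps of U(g) are obtained by letting [u] act on a unit
   element.  [comulU] is the algebra map with x |-> x (x) 1 + 1 (x) x
   ([comulU_gen], [comulUM]), [antipodeU] the algebra antimap with x |-> - x
   ([antipodeU_gen], [antipodeUM]), and [charU chi], for a character [chi] of
   g, the algebra map extending [chi] ([charU_gen], [charUM]). *)
Definition comulU_act (x : g) (t : U ⊗ U) : U ⊗ U :=
  \tsum_(a, b <- t) (uiota x * a ⊗ b + a ⊗ uiota x * b).
Definition comulU (u : U) : U ⊗ U := uact comulU_act u (1 ⊗ 1).

Definition antipodeU_act (x : g) (v : U) : U := - (v * uiota x).
Definition antipodeU (u : U) : U := uact antipodeU_act u 1.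

Definition charU_act (chi : g -> K) (x : g) (c : K^o) : K^o := chi x * c.
Definition charU (chi : g -> K) (u : U) : K := uact (charU_act chi) u (1 : K^o).

Definition counitU : U -> K := charU (fun=> 0).

End HopfEnveloping.

Section Basis.
Variables (K : fieldType) (g : lieAlgType K) (X : (\dim {:g}).-tuple g).

Definition struct_const (i j k : 'I_(\dim {:g})) : K := coord X k [[X`_i, X`_j]].

Definition ad_mx (x : g) : 'M[K]_(\dim {:g}) :=
  \matrix_(i, j) coord X i [[x, X`_j]].

(* The algebra map extending x |-> Tr (ad x); see [delta_g_gen], [delta_gM]. *)
Definition delta_g (u : envalg g) : K := charU (fun x => \tr (ad_mx x)) u.

(* [coef_mx rho i j] is f^i_j in rho(X_j) = sum_i X_i (x) f^i_j. *)
Definition coef_mx (F : comHopfAlgType K) (rho : g -> g ⊗ F) :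
    'M[F]_(\dim {:g}) :=
  \matrix_(i, j) \tsum_(x, f <- rho X`_j) coord X i x *: f.

(* g-Hopf algebra structures on F; [X] is the basis in which the structure
   identity is written, with [f i j] = f^i_j and [gact X_k (f i j)] = f^i_{j,k}. *)
Record gHopfAlgebra (F : comHopfAlgType K) := GHopfAlgebra {
  gact : g -> F -> F;
  gcoact : g -> g ⊗ F;
  gact_lie : lie_module gact;
  gact_der : forall x f h, gact x (f * h) = gact x f * h + f * gact x h;
  gcoact_comod : right_comodule gcoact;
  gcoact_struct : forall i j k : 'I_(\dim {:g}),
    let f := coef_mx gcoact in
    gact X`_i (f k j) - gact X`_j (f k i) =
      \sum_s \sum_r struct_const s r k *: (f r i * f s j)
      + \sum_l struct_const i j l *: f k l;
  gact_counit : forall x f, counit (gact x f) = 0;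
  gact_comul : forall x f, comul (gact x f) =
    \tsum_(x0, x1 <- gcoact x) \tsum_(f1, f2 <- comul f) gact x0 f1 ⊗ x1 * f2
    + \tsum_(f1, f2 <- comul f) f1 ⊗ gact x f2
}.

End Basis.

Section Bicrossed.
Variables (K : fieldType) (g : lieAlgType K) (X : (\dim {:g}).-tuple g).
Variables (F : comHopfAlgType K) (A : gHopfAlgebra X F).
Local Notation U := (envalg g).

Definition uactF (u : U) (f : F) : F := uact (gact A) u f.

(* The extension of the coaction to U(g), defined by iterating
   rho(x v) = x_<0> v_<0> (x) x_<1> v_<1> + v_<0> (x) x |> v_<1>; the formula for
   a general product u v is [coactUM]. *)
Definition coactU_act (x : g) (t : U ⊗ F) : U ⊗ F :=
  \tsum_(v, f <- t) \tsum_(x0, x1 <- gcoact A x) uiota x0 * v ⊗ x1 * f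
  + \tsum_(v, f <- t) v ⊗ gact A x f.
Definition coactU (u : U) : U ⊗ F := uact coactU_act u (1 ⊗ 1).

Definition sigmaF : F := \det (coef_mx X (gcoact A)).

End Bicrossed.

(* The operations of a Hopf algebra, without its axioms: they are all that the
   definition of a SAYD module refers to. *)
Record hopfOps (K : fieldType) (H : lmodType K) := HopfOps {
  hone : H;
  hmul : H -> H -> H;
  hcomul : H -> H ⊗ H;
  hcounit : H -> K;
  hantipode : H -> H
}.

Definition bicrossed (K : fieldType) (g : lieAlgType K)
    (X : (\dim {:g}).-tuple g) (F : comHopfAlgType K) (A : gHopfAlgebra X F) :
    hopfOps (F ⊗ envalg g)%type :=
  let mul h k :=
    \tsum_(f, u <- h) \tsum_(f', v <- k) \tsum_(u1, u2 <- comulU u)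
      f * uactF A u1 f' ⊗ u2 * v in
  {| hone := 1 ⊗ 1;
     hmul := mul;
     hcomul h :=
       \tsum_(f, u <- h) \tsum_(f1, f2 <- comul f) \tsum_(u1, u2 <- comulU u)
       \tsum_(u10, u11 <- coactU A u1) (f1 ⊗ u10) ⊗ (f2 * u11 ⊗ u2);
     hcounit h := \tsum_(f, u <- h) (counit f * counitU u : K^o);
     hantipode h :=
       \tsum_(f, u <- h) \tsum_(u0, u1 <- coactU A u)
         mul (1 ⊗ antipodeU u0) (antipode (f * u1) ⊗ 1) |}.

Record induced_module (K : fieldType) (g : lieAlgType K)
    (X : (\dim {:g}).-tuple g) (F : comHopfAlgType K) (A : gHopfAlgebra X F)
    (M : lmodType K) := InducedModule {
  ind_act : g -> M -> M;
  ind_coact : M -> M ⊗ F;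
  ind_act_lie : lie_module ind_act;
  ind_coact_comod : right_comodule ind_coact;
  ind_compat : forall x m, ind_coact (ind_act x m) =
    \tsum_(x0, x1 <- gcoact A x) \tsum_(m0, m1 <- ind_coact m)
      ind_act x0 m0 ⊗ x1 * m1
    + \tsum_(m0, m1 <- ind_coact m) m0 ⊗ gact A x m1
}.

(* In Sweedler sums over a left comodule, [n1] and [n0] stand for n_<-1> and
   n_<0>. *)
Section SAYD.
Variables (K : fieldType) (H : lmodType K) (o : hopfOps H) (N : lmodType K).

Definition right_module (act : N -> H -> N) : Prop :=
  [/\ bilin act, forall n, act n (hone o) = n
    & forall n h k, act n (hmul o h k) = act (act n h) k].

Definition left_comodule (rho : N -> H ⊗ N) : Prop :=
  [/\ linear rho,
      forall n, \tsum_(h, n0 <- rho n) \tsum_(h1, h2 <- hcomul o h) h1 ⊗ (h2 ⊗ n0)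
                = \tsum_(h, n0 <- rho n) h ⊗ rho n0
    & forall n, \tsum_(h, n0 <- rho n) hcounit o h *: n0 = n].

Definition anti_yetter_drinfeld (act : N -> H -> N) (rho : N -> H ⊗ N) : Prop :=
  forall n h, rho (act n h) =
    \tsum_(h1, h23 <- hcomul o h) \tsum_(h2, h3 <- hcomul o h23)
    \tsum_(n1, n0 <- rho n)
      hmul o (hmul o (hantipode o h3) n1) h1 ⊗ act n0 h2.

Definition stable (act : N -> H -> N) (rho : N -> H ⊗ N) : Prop :=
  forall n, \tsum_(n1, n0 <- rho n) act n0 n1 = n.

Definition is_SAYD (act : N -> H -> N) (rho : N -> H ⊗ N) : Prop :=
  [/\ right_module act, left_comodule rho,
      anti_yetter_drinfeld act rho & stable act rho].

End SAYD.


Section HopfEnvelopingFacts.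
Variables (K : fieldType) (g : lieAlgType K).
Local Notation U := (envalg g).
Implicit Types (x y : g) (a b u v : U).

Lemma uiotaD x y : uiota (x + y) = uiota x + uiota y.
Proof. exact: (linD (@uiota_linear K g)). Qed.

Lemma uiotaZ k x : uiota (k *: x) = k *: uiota x.
Proof. exact: (linZ (@uiota_linear K g)). Qed.

Let zid (Z : zmodType) (P Q R S V W : Z) :
  P - Q + (R - S) = P + V + (W + R) - (Q + W + (V + S)).
Proof.
have -> : P + V + (W + R) = P + R + (V + W) by rewrite [W + R]addrC addrACA.
have -> : Q + W + (V + S) = Q + S + (V + W) by rewrite [V + S]addrC addrACA [W + V]addrC.
by rewrite (opprD (Q + S)) [RHS]addrACA subrr addr0 opprD [RHS]addrACA.
Qed.

Let comul_bil x : bilin (fun a b : U => uiota x * a ⊗ b + a ⊗ uiota x * b).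
Proof. by split=> [b k a a'|a k b b']; lin_expand; rewrite addrACA. Qed.

Lemma comulU_act_tens x a b :
  comulU_act x (a ⊗ b) = uiota x * a ⊗ b + a ⊗ uiota x * b.
Proof. by rewrite /comulU_act tsum_tens //; exact: comul_bil. Qed.

Lemma comulU_act_lie : lie_module (@comulU_act K g).
Proof.
have lt x : linear (@comulU_act K g x) by apply: tsum_linear; exact: comul_bil.
split; first split=> // t.
  apply: tsum_linear_param => a b k x y.
  by rewrite uiotaD uiotaZ; lin_expand; rewrite addrACA.
move=> x y.
pose F t := comulU_act x (comulU_act y t) - comulU_act y (comulU_act x t).
apply: (@lin_tens_ext _ _ _ _ _ F) => //.
  move=> k s t; rewrite /F !lt scalerBr opprD.
  by rewrite addrACA.
move=> a b; rewrite /F !comulU_act_tens !(linD (lt _)) !comulU_act_tens.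
rewrite uiota_bracket !(mulrDl, tensDl, tensDr, mulNr).
rewrite -!scaleN1r !(tensZl, tensZr) !scaleN1r !mulrA.
exact: zid.
Qed.

Lemma comulU_linear : linear (@comulU K g).
Proof. exact: (uact_bilin comulU_act_lie).1. Qed.

Lemma comulU1 : comulU (1 : U) = 1 ⊗ 1.
Proof. exact: (uact1 comulU_act_lie). Qed.

Lemma comulU_cons x u : comulU (uiota x * u) = comulU_act x (comulU u).
Proof. by rewrite /comulU (uactM comulU_act_lie) (uact_gen comulU_act_lie). Qed.

Lemma comulU_gen x : comulU (uiota x) = uiota x ⊗ 1 + 1 ⊗ uiota x.
Proof. by rewrite -[uiota x]mulr1 comulU_cons comulU1 comulU_act_tens !mulr1. Qed.

Lemma comulUM u v : comulU (u * v) =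
  \tsum_(u1, u2 <- comulU u) \tsum_(v1, v2 <- comulU v) u1 * v1 ⊗ u2 * v2.
Proof.
pose f t (p q : U) : U ⊗ U := \tsum_(v1, v2 <- t) p * v1 ⊗ q * v2.
have bi p q : bilin (fun v1 v2 : U => p * v1 ⊗ q * v2).
  by split=> [b k a a'|a k b b']; lin_expand.
have bf t : bilin (f t).
  split=> [q|p]; apply: tsum_linear_param => a b k c d; by lin_expand.
have lm x : linear (@comulU_act K g x) by exact: comulU_act_lie.1.2.
have ltf p q : linear (fun t => f t p q) by exact: tsum_linear.
change (comulU (u * v) = tsum (comulU u) (f (comulU v))).
elim/envalg_ind: u => [|k u IH|u w IHu IHw|x u IH].
- rewrite mul1r comulU1 tsum_tens //.
  rewrite [LHS]tens_sumE /f; apply: tsum_eq => a b; by rewrite !mul1r.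
- rewrite -scalerAl !(linZ comulU_linear) IH.
  by rewrite (linZ (tsum_linear (bf _))).
- rewrite mulrDl !(linD comulU_linear) IHu IHw.
  by rewrite (linD (tsum_linear (bf _))).
- rewrite -mulrA !comulU_cons IH.
  move: (comulU u) (comulU v) => s t.
  pose G s := comulU_act x (tsum s (f t)).
  pose G' s := tsum (comulU_act x s) (f t).
  apply: (@lin_tens_ext _ _ _ _ G G'); rewrite /G /G'.
  + by move=> k r r'; rewrite (tsum_linear (bf t)) lm.
  + by move=> k r r'; rewrite lm (tsum_linear (bf t)).
  move=> p q; rewrite comulU_act_tens (linD (tsum_linear (bf t))) !tsum_tens //.
  rewrite (lin_tsum _ _ (lm x)) /f -tsumD; apply: tsum_eq => a b.
  by rewrite comulU_act_tens !mulrA.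
Qed.

Lemma antipodeU_act_lie : lie_module (@antipodeU_act K g).
Proof.
split; first split=> [v k x y|x k u v]; rewrite /antipodeU_act.
- by rewrite uiotaD uiotaZ; lin_expand.
- by lin_expand.
- move=> x y m; rewrite /antipodeU_act uiota_bracket.
  by rewrite !mulNr !opprK mulrBr !mulrA opprB.
Qed.

Lemma antipodeU_linear : linear (@antipodeU K g).
Proof. exact: (uact_bilin antipodeU_act_lie).1. Qed.

Lemma antipodeU1 : antipodeU (1 : U) = 1.
Proof. exact: (uact1 antipodeU_act_lie). Qed.

Lemma antipodeU_cons x u : antipodeU (uiota x * u) = - (antipodeU u * uiota x).
Proof.
by rewrite /antipodeU (uactM antipodeU_act_lie) (uact_gen antipodeU_act_lie).
Qed.

Lemma antipodeU_gen x : antipodeU (uiota x) = - uiota x.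
Proof. by rewrite -[in LHS](mulr1 (uiota x)) antipodeU_cons antipodeU1 mul1r. Qed.

Lemma antipodeUM u v : antipodeU (u * v) = antipodeU v * antipodeU u.
Proof.
have lA := antipodeU_linear.
elim/envalg_ind: u => [|k u IH|u w IHu IHw|x u IH].
- by rewrite mul1r antipodeU1 mulr1.
- by rewrite -scalerAl !(linZ lA) IH scalerAr.
- by rewrite mulrDl !(linD lA) IHu IHw mulrDr.
- by rewrite -mulrA !antipodeU_cons IH mulrN mulrA.
Qed.

Section Character.
Variable chi : g -> K.
Hypotheses (chi_lin : scalar chi) (chi_lie : forall x y, chi [[x, y]] = 0).

Let chi_act : lie_module (charU_act chi).
Proof.
split; first split=> [c k x y|x k c d]; rewrite /charU_act.
- by rewrite chi_lin mulrDl -mulrA.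
- by rewrite mulrDr mulrCA.
- by move=> x y m; rewrite /charU_act chi_lie mul0r mulrCA subrr.
Qed.

Lemma charU_linear : scalar (charU chi).
Proof. exact: (uact_bilin chi_act).1. Qed.

Lemma charU1 : charU chi 1 = 1.
Proof. exact: (uact1 chi_act). Qed.

Lemma charU_gen x : charU chi (uiota x) = chi x.
Proof. by rewrite /charU (uact_gen chi_act) /charU_act mulr1. Qed.

Lemma charUM u v : charU chi (u * v) = charU chi u * charU chi v.
Proof.
rewrite /charU (uactM chi_act) [RHS]mulrC; set c := uact _ v 1.
have := linZ ((uact_bilin chi_act).2 u) c (1 : K^o).
by rewrite [c *: _]mulr1.
Qed.

End Character.

End HopfEnvelopingFacts.

Section CoactionFacts.
Variables (K : fieldType) (g : lieAlgType K) (X : (\dim {:g}).-tuple g).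
Variables (F : comHopfAlgType K) (A : gHopfAlgebra X F).
Hypothesis hX : basis_of {:g} X.
Local Notation U := (envalg g).
Local Notation n := (\dim {:g}).
Local Notation coef := (coef_mx X (gcoact A)).
Implicit Types (x y : g) (u v : U) (f h : F) (t : U ⊗ F).

Lemma lie_bracketC x y : [[x, y]] = - [[y, x]].
Proof.
have [bl br] := @lie_bracket_bilin K g.
have := lie_bracketxx (x + y); rewrite (linD (bl _)) !(linD (br _)).
rewrite !lie_bracketxx add0r addr0 => /eqP; rewrite addr_eq0 => /eqP.
exact.
Qed.

Lemma basisE x : x = \sum_(i < n) coord X i x *: X`_i.
Proof. exact: coord_basis hX (memvf x). Qed.

Lemma tens_basisE (t : g ⊗ F) :
  t = \sum_(i < n) (X`_i ⊗ \tsum_(x, f <- t) coord X i x *: f).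
Proof.
rewrite {1}(tens_sumE t) /tsum.
under [RHS]eq_bigr => i _ do rewrite (lin_sum ((tens_bilin g F).2 _)).
rewrite exchange_big /=; apply: eq_bigr => p _.
rewrite {1}(basisE p.1) (lin_sum ((tens_bilin g F).1 _)).
by apply: eq_bigr => i _; rewrite tensZl tensZr.
Qed.

Lemma gcoact_basis (j : 'I_n) : gcoact A X`_j = \sum_(i < n) (X`_i ⊗ coef i j).
Proof.
by rewrite {1}(tens_basisE (gcoact A _)); apply: eq_bigr => i _; rewrite mxE.
Qed.

Lemma gact_linear x : linear (gact A x).
Proof. exact: (gact_lie A).1.2. Qed.

Let mul_bil v f : bilin (fun x f' => uiota x * v ⊗ f' * f).
Proof. by split=> [f' k x y|x k f' f'']; rewrite ?uiotaD ?uiotaZ; lin_expand. Qed.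

Let act_bil x : bilin (fun v f => v ⊗ gact A x f).
Proof.
split=> [f k u v|v k f h]; first by lin_expand.
by rewrite gact_linear; lin_expand.
Qed.

Let coact_bil (s : g ⊗ F) :
  bilin (fun v f => \tsum_(x0, x1 <- s) uiota x0 * v ⊗ x1 * f).
Proof.
by split=> [f|v]; apply: tsum_linear_param => x f' k a b; lin_expand.
Qed.

Lemma coactU_act_tens x v f : coactU_act A x (v ⊗ f) =
  \tsum_(x0, x1 <- gcoact A x) uiota x0 * v ⊗ x1 * f + v ⊗ gact A x f.
Proof. by rewrite /coactU_act !tsum_tens. Qed.

Lemma coactU_act_linear x : linear (coactU_act A x).
Proof.
move=> k s t; rewrite /coactU_act (tsum_linear (coact_bil _)).
by rewrite (tsum_linear (act_bil x)) scalerDr addrACA.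
Qed.

Lemma coactU_act_linearl t : linear (fun x => coactU_act A x t).
Proof.
move=> k x y; rewrite /coactU_act scalerDr addrACA; congr (_ + _).
  rewrite -tsumZ -tsumD; apply: tsum_eq => v f.
  have [cl _ _] := gcoact_comod A.
  by rewrite cl (tsum_linear (mul_bil v f)).
rewrite -tsumZ -tsumD; apply: tsum_eq => v f.
by rewrite ((gact_lie A).1.1 f) tensDr tensZr.
Qed.

Lemma coactU_act_basis (j : 'I_n) v f : coactU_act A X`_j (v ⊗ f) =
  \sum_(i < n) (uiota X`_i * v ⊗ coef i j * f) + v ⊗ gact A X`_j f.
Proof.
rewrite coactU_act_tens gcoact_basis (lin_sum (tsum_linear (mul_bil v f))).
by congr (_ + _); apply: eq_bigr => i _; rewrite tsum_tens.
Qed.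

Lemma coactU_act_comp (i j : 'I_n) v h :
  coactU_act A X`_i (coactU_act A X`_j (v ⊗ h)) =
  \sum_(r < n) \sum_(s < n)
     (uiota X`_s * (uiota X`_r * v) ⊗ coef s i * (coef r j * h))
  + \sum_(r < n) (uiota X`_r * v ⊗ gact A X`_i (coef r j) * h)
  + (\sum_(r < n) (uiota X`_r * v ⊗ coef r j * gact A X`_i h)
     + \sum_(r < n) (uiota X`_r * v ⊗ coef r i * gact A X`_j h))
  + v ⊗ gact A X`_i (gact A X`_j h).
Proof.
have l := coactU_act_linear X`_i.
rewrite coactU_act_basis (linD l) (lin_sum l) coactU_act_basis !addrA.
congr (_ + _ + _); rewrite -!big_split /=; apply: eq_bigr => r _.
by rewrite coactU_act_basis gact_der tensDr addrA.
Qed.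

Let zid (Z : zmodType) (P P' Q Q' R S V V' : Z) :
  P + Q + (R + S) + V - (P' + Q' + (S + R) + V') = (P - P') + (Q - Q') + (V - V').
Proof.
rewrite [S + R]addrC opprD addrACA; congr (_ + _).
by rewrite opprD addrACA subrr addr0 opprD addrACA.
Qed.

Lemma struct_constE (i j : 'I_n) :
  [[X`_i, X`_j]] = \sum_k struct_const X i j k *: X`_k.
Proof. exact: basisE. Qed.

Lemma struct_constC (i j k : 'I_n) : struct_const X i j k = - struct_const X j i k.
Proof. by rewrite /struct_const lie_bracketC linearN. Qed.

Let quad_part (i j : 'I_n) v h :
  \sum_(r < n) \sum_(s < n)
     (uiota X`_s * (uiota X`_r * v) ⊗ coef s i * (coef r j * h))
  - \sum_(r < n) \sum_(s < n)
     (uiota X`_s * (uiota X`_r * v) ⊗ coef s j * (coef r i * h))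
  = - \sum_(k < n) (uiota X`_k * v ⊗
     (\sum_s \sum_r struct_const X s r k *: (coef r i * coef s j)) * h).
Proof.
pose B (a : U) (f : F) := a * v ⊗ f * h.
have bB : bilin B by split=> [f k a b|a k f f']; rewrite /B; lin_expand.
rewrite [X in _ - X]exchange_big -sumrB.
transitivity (\sum_(r < n) \sum_(s < n)
    B (uiota [[X`_s, X`_r]]) (coef s i * coef r j)).
  apply: eq_bigr => r _; rewrite -sumrB; apply: eq_bigr => s _.
  rewrite uiota_bracket (linD (bB.1 _)) (linN (bB.1 _)) /B !mulrA.
  by rewrite (mulrC (coef r j)).
rewrite -sumrN.
transitivity (\sum_(r < n) \sum_(s < n) \sum_(k < n)
    - (struct_const X r s k *: B (uiota X`_k) (coef s i * coef r j))).
  apply: eq_bigr => r _; apply: eq_bigr => s _.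
  rewrite struct_constE (lin_sum (@uiota_linear K g)) (lin_sum (bB.1 _)).
  apply: eq_bigr => k _; rewrite uiotaZ (linZ (bB.1 _)) struct_constC.
  by rewrite scaleNr.
under eq_bigr => r _ do rewrite exchange_big.
rewrite exchange_big; apply: eq_bigr => k _.
rewrite -[RHS]/(- B _ _) (lin_sum (bB.2 _)) -sumrN; apply: eq_bigr => r _.
rewrite (lin_sum (bB.2 _)) -sumrN; apply: eq_bigr => s _.
by rewrite (linZ (bB.2 _)).
Qed.

Lemma coactU_act_basis_lie (i j : 'I_n) t :
  coactU_act A [[X`_i, X`_j]] t =
  coactU_act A X`_i (coactU_act A X`_j t)
  - coactU_act A X`_j (coactU_act A X`_i t).
Proof.
pose G t := coactU_act A X`_i (coactU_act A X`_j t)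
  - coactU_act A X`_j (coactU_act A X`_i t).
apply: (@lin_tens_ext _ _ _ _ _ G).
- exact: coactU_act_linear.
- by move=> k s r; rewrite /G !coactU_act_linear scalerBr opprD addrACA.
move=> v h; rewrite /G !coactU_act_comp zid quad_part.
have tv := (tens_bilin U F).2 v.
rewrite -[X in _ = _ + X]/(v ⊗ _ - _) -(linN tv) -(linD tv) -(gact_lie A).2.
rewrite coactU_act_tens; congr (_ + _).
rewrite -sumrN -!sumrB -big_split /=.
rewrite struct_constE; have [cl _ _] := gcoact_comod A.
rewrite (lin_sum cl) (lin_sum (tsum_linear (mul_bil v h))).
transitivity (\sum_(l < n) \sum_(k < n)
   struct_const X i j l *: (uiota X`_k * v ⊗ coef k l * h)).
  apply: eq_bigr => l _; rewrite (linZ cl) (linZ (tsum_linear (mul_bil v h))).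
  rewrite gcoact_basis (lin_sum (tsum_linear (mul_bil v h))) scaler_sumr.
  by apply: eq_bigr => k _; rewrite tsum_tens.
rewrite exchange_big; apply: eq_bigr => k _.
pose B f := uiota X`_k * v ⊗ f * h.
have lB : linear B by move=> c f f'; rewrite /B; lin_expand.
rewrite -[RHS]/(- B _ + (B _ - B _)) -!(linN lB) -!(linD lB).
rewrite gcoact_struct addrA addNr add0r (lin_sum lB).
by apply: eq_bigr => l _; rewrite (linZ lB).
Qed.

Let zid2 (Z : zmodType) (a b c a' b' c' : Z) :
  (a + a') - ((b + b') - (c + c')) = (a - (b - c)) + (a' - (b' - c')).
Proof.
have -> : (b + b') - (c + c') = (b - c) + (b' - c') by rewrite opprD addrACA.
by rewrite opprD addrACA.
Qed.

Lemma coactU_act_lie : lie_module (coactU_act A).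
Proof.
have ll := coactU_act_linearl; have lr := coactU_act_linear.
split=> // x y t; have [bl br] := @lie_bracket_bilin K g.
pose E x y := coactU_act A [[x, y]] t -
  (coactU_act A x (coactU_act A y t) - coactU_act A y (coactU_act A x t)).
suff -> : coactU_act A [[x, y]] t = E x y +
  (coactU_act A x (coactU_act A y t) - coactU_act A y (coactU_act A x t)).
  suff -> : E x y = 0 by rewrite add0r.
  have El z : linear (E^~ z).
    move=> k a b; rewrite /E (bl z) !ll lr.
    by rewrite zid2 -!scalerBr.
  have Er z : linear (E z).
    move=> k a b; rewrite /E (br z) !ll lr.
    by rewrite zid2 -!scalerBr.
  rewrite (basisE x) (lin_sum (El y)) big1 // => i _.
  rewrite (linZ (El y)) (basisE y) (lin_sum (Er _)) big1 ?scaler0 // => j _.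
  by rewrite (linZ (Er _)) /E coactU_act_basis_lie subrr scaler0.
by rewrite /E subrK.
Qed.

Lemma coactU_linear : linear (coactU A).
Proof. exact: (uact_bilin coactU_act_lie).1. Qed.

Lemma coactU1 : coactU A 1 = 1 ⊗ 1.
Proof. exact: (uact1 coactU_act_lie). Qed.

Lemma coactU_cons x u : coactU A (uiota x * u) = coactU_act A x (coactU A u).
Proof. by rewrite /coactU (uactM coactU_act_lie) (uact_gen coactU_act_lie). Qed.

Lemma gact1 x : gact A x 1 = 0.
Proof.
have /eqP := gact_der A x 1 1; rewrite !mulr1 mul1r.
by rewrite -subr_eq subrr eq_sym => /eqP.
Qed.

Lemma coactU_gen x :
  coactU A (uiota x) = \tsum_(x0, x1 <- gcoact A x) uiota x0 ⊗ x1.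
Proof.
rewrite -[uiota x]mulr1 coactU_cons coactU1 coactU_act_tens gact1.
rewrite (lin0 ((tens_bilin _ _).2 _)) addr0.
by apply: tsum_eq => a b; rewrite !mulr1.
Qed.

Lemma coactUM u v : coactU A (u * v) =
  \tsum_(u1, u2 <- comulU u) \tsum_(u10, u11 <- coactU A u1)
  \tsum_(v0, v1 <- coactU A v) u10 * v0 ⊗ u11 * uactF A u2 v1.
Proof.
have lF := gact_lie A; have [uFl uFr] := uact_bilin lF.
pose e q t (a : U) (b : F) : U ⊗ F := \tsum_(v0, v1 <- t) a * v0 ⊗ b * uactF A q v1.
have bi q (a : U) (b : F) : bilin (fun (v0 : U) (v1 : F) => a * v0 ⊗ b * uactF A q v1).
  split=> [f k c d|c k f h]; first by lin_expand.
  by rewrite /uactF uFr; lin_expand.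
have be q t : bilin (e q t).
  by split=> [b|a]; apply: tsum_linear_param => c d k r s; lin_expand.
pose d t p q := tsum (coactU A p) (e q t).
have bd t : bilin (d t).
  split=> [q k p p'|p]; first by rewrite /d coactU_linear (tsum_linear (be q t)).
  apply: tsum_linear_param => a b; apply: tsum_linear_param => c f k q q'.
  by rewrite /uactF uFl; lin_expand.
change (coactU A (u * v) = tsum (comulU u) (d (coactU A v))).
elim/envalg_ind: u => [|k u IH|u w IHu IHw|x u IH].
- rewrite mul1r comulU1 tsum_tens // /d coactU1 tsum_tens // /e.
  rewrite [LHS]tens_sumE; apply: tsum_eq => a b.
  by rewrite !mul1r /uactF uact1.
- rewrite -scalerAl (linZ coactU_linear) (linZ (@comulU_linear _ _)) IH.
  by rewrite (linZ (tsum_linear (bd _))).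
- rewrite mulrDl (linD coactU_linear) (linD (@comulU_linear _ _)) IHu IHw.
  by rewrite (linD (tsum_linear (bd _))).
rewrite -mulrA coactU_cons comulU_cons IH.
move: (comulU u) (coactU A v) => s t.
have lx := coactU_act_linear x; have lc : linear (@comulU_act K g x).
  exact: (comulU_act_lie g).1.2.
pose G s := coactU_act A x (tsum s (d t)).
pose G' s := tsum (comulU_act x s) (d t).
apply: (@lin_tens_ext _ _ _ _ G G'); rewrite /G /G'.
- by move=> k r r'; rewrite (tsum_linear (bd t)) lx.
- by move=> k r r'; rewrite lc (tsum_linear (bd t)).
move=> p q; rewrite comulU_act_tens (linD (tsum_linear (bd t))) !tsum_tens //.
rewrite /d coactU_cons; move: (coactU A p) => r.
pose H r := coactU_act A x (tsum r (e q t)).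
pose H' r := tsum (coactU_act A x r) (e q t) + tsum r (e (uiota x * q) t).
apply: (@lin_tens_ext _ _ _ _ H H'); rewrite /H /H'.
- by move=> k c c'; rewrite (tsum_linear (be q t)) lx.
- move=> k c c'; rewrite lx !(tsum_linear (be _ t)) scalerDr.
  by rewrite addrACA.
move=> a b; rewrite coactU_act_tens (linD (tsum_linear (be q t))) !tsum_tens //.
rewrite (lin_tsum _ _ (tsum_linear (be q t))) (lin_tsum _ _ lx).
pose m v f w h : U ⊗ F := w * v ⊗ h * f.
transitivity (\tsum_(v0, v1 <- t)
  (\tsum_(x0, x1 <- gcoact A x) uiota x0 * (a * v0) ⊗ x1 * (b * uactF A q v1)
   + a * v0 ⊗ gact A x (b * uactF A q v1))).
  by apply: tsum_eq => v0 v1; rewrite coactU_act_tens.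
rewrite tsumD -addrA; congr (_ + _).
  rewrite /tsum exchange_big; apply: eq_bigr => z _.
  rewrite -[RHS]/(tsum _ _) tsum_tens // /e /tsum.
  by apply: eq_bigr => y _; rewrite !mulrA.
rewrite -tsumD; apply: tsum_eq => v0 v1.
by rewrite gact_der tensDr /uactF (uactM lF) (uact_gen lF).
Qed.

End CoactionFacts.

Section ModularCharacterFacts.
Variables (K : fieldType) (g : lieAlgType K) (X : (\dim {:g}).-tuple g).
Hypothesis hX : basis_of {:g} X.

Lemma ad_mx_linear : linear (ad_mx X).
Proof.
move=> k x y; apply/matrixP => i j; rewrite !mxE.
by rewrite ((@lie_bracket_bilin K g).1 _) linearP.
Qed.

Lemma ad_mx_mul x y (i j : 'I_(\dim {:g})) :
  (ad_mx X x *m ad_mx X y) i j = coord X i [[x, [[y, X`_j]]]].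
Proof.
have br := (@lie_bracket_bilin K g).2 x.
rewrite !mxE [in RHS](basisE hX [[y, X`_j]]) (lin_sum br) linear_sum.
by apply: eq_bigr => k _; rewrite !mxE (linZ br) linearZ mulrC.
Qed.

Lemma ad_mx_bracket x y :
  ad_mx X [[x, y]] = ad_mx X x *m ad_mx X y - ad_mx X y *m ad_mx X x.
Proof.
apply/matrixP => i j; rewrite [RHS]mxE [X in _ + X]mxE !ad_mx_mul mxE -linearB.
congr (coord X i _).
have br := (@lie_bracket_bilin K g).2.
have /eqP := lie_jacobi x y X`_j; rewrite addr_eq0 => /eqP e.
rewrite (lie_bracketC [[x, y]]) -e (lie_bracketC X`_j x).
by rewrite (linN (br y)).
Qed.

Lemma tr_ad_scalar : scalar (fun x => \tr (ad_mx X x)).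
Proof. by move=> k x y; rewrite ad_mx_linear linearP. Qed.

Lemma tr_ad_bracket x y : \tr (ad_mx X [[x, y]]) = 0.
Proof. by rewrite ad_mx_bracket linearB /= mxtrace_mulC subrr. Qed.

Lemma delta_g1 : delta_g X 1 = 1.
Proof. exact: charU1 tr_ad_scalar tr_ad_bracket. Qed.

Lemma delta_g_gen x : delta_g X (uiota x) = \tr (ad_mx X x).
Proof. exact: charU_gen tr_ad_scalar tr_ad_bracket x. Qed.

Lemma delta_gM u v : delta_g X (u * v) = delta_g X u * delta_g X v.
Proof. exact: charUM tr_ad_scalar tr_ad_bracket u v. Qed.

End ModularCharacterFacts.

(* Main.v *)
(* Write m ◁ u = delta_g(u_(1)) S(u_(2)) m, and let G_v(f, m) be
   S(h_(3)) (f (x) 1) h_(1) (x) m ◁ h_(2) for h = 1 (x) v.  The anti-Yetter-Drinfeld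
   condition for f (x) v reduces, since F is commutative, to
     G_v(sigma S(m_<1>), m_<0>) = coaction of (m ◁ v),
   and is proved by induction on v: for x in g,
     G_{xv}(f, m) = G_v(f S(x_<1>), m ◁ x_<0>) - G_v(x_<0> |> (S(x_<1>) f), m).
   This uses S(x |> f) = S(x_<1>) (x_<0> |> S(f)).  The induction step
   then amounts to the compatibility of M together with the identity
     x_<0> |> (S(x_<1>) sigma) = delta_g(x_<0>) S(x_<1>) sigma - delta_g(x) sigma,
   which is where sigma = det[f^i_j] and delta_g = Tr ad enter.  The comodule axioms
   and stability follow from sigma being grouplike. *)

From HB Require Import structures.
Require Import Defs.
From mathcomp Require Import all_boot all_order all_algebra.
From mathcomp Require Import perm boolp reals complex.

Set Implicit Arguments.
Unset Strict Implicit.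
Unset Printing Implicit Defensive.

Import GRing.Theory.

Local Open Scope ring_scope.

(** G_v carries free arguments f and m because removing a generator from v changes both. The
    generator is removed on the left: in a right action it acts first, so the claim for v is then
    used at m ◁ x. The shape of G_v comes from [F] acting through the counit. For h = f (x) v the
    [F]-component of h_(2) is absorbed by counitality, so the [F]-components of the coactions of
    v_(1), v_(2), v_(3) end up multiplied together inside the antipode of h_(3). Commutativity also
    gathers f_(1) S(f_(2)) = counit(f), which leaves only h = 1 (x) v. In the recursion the
    generator enters all three legs. In S(h_(3)) it appears with a minus sign and must be moved past
    the coefficient; this undoes its contribution to h_(1), and only the action on m and a
    derivative of f survive. *)

Section Linearity.
Variables (K : fieldType) (U V W : lmodType K).

Lemma lin_id : linear (fun v : V => v).
Proof. by []. Qed.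

Lemma lin_comp (f : V -> W) (h : U -> V) :
  linear f -> linear h -> linear (fun u => f (h u)).
Proof. by move=> lf lh k u v; rewrite lh lf. Qed.

Lemma scalar_comp (f : V -> K) (h : U -> V) :
  scalar f -> linear h -> scalar (fun u => f (h u)).
Proof. by move=> lf lh k u v; rewrite lh lf. Qed.

Lemma lin_add (f h : V -> W) :
  linear f -> linear h -> linear (fun v => f v + h v).
Proof. by move=> lf lh k u v; rewrite lf lh scalerDr addrACA. Qed.

Lemma lin_opp (f : V -> W) : linear f -> linear (fun v => - f v).
Proof. by move=> lf k u v; rewrite lf opprD scalerN. Qed.

Lemma lin_scale k (f : V -> W) : linear f -> linear (fun v => k *: f v).
Proof. by move=> lf l u v; rewrite lf scalerDr !scalerA mulrC. Qed.

Lemma lin_scalel (c : V -> K) (w : W) : scalar c -> linear (fun v => c v *: w).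
Proof. by move=> lc k u v; rewrite lc scalerDl scalerA. Qed.

Lemma scalar_mull (c : V -> K) (l : K) : scalar c -> scalar (fun v => c v * l).
Proof. by move=> lc k u v; rewrite lc mulrDl mulrA. Qed.

Lemma scalar_mulr (c : V -> K) (l : K) : scalar c -> scalar (fun v => l * c v).
Proof. by move=> lc k u v; rewrite lc mulrDr mulrCA. Qed.

End Linearity.

Section LinearityAlgebra.
Variables (K : fieldType) (B : algType K).

Lemma lin_mull (b : B) : linear (fun a => a * b).
Proof. by move=> k u v; rewrite mulrDl scalerAl. Qed.

Lemma lin_mulr (b : B) : linear (fun a => b * a).
Proof. by move=> k u v; rewrite mulrDr scalerAr. Qed.

End LinearityAlgebra.

(** * Calculus of Sweedler sums *)

Section TsumRules.
Variables (K : fieldType) (V W Z : lmodType K).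

Lemma tsum_tsum (V' W' : lmodType K) (t : V' ⊗ W') (h : V' -> W' -> V ⊗ W)
    (f : V -> W -> Z) : bilin f ->
  tsum (tsum t h) f = tsum t (fun a b => tsum (h a b) f).
Proof. by move=> bf; rewrite (lin_tsum _ _ (tsum_linear bf)). Qed.

Lemma tsum_exchange (V' W' : lmodType K) (s : V ⊗ W) (t : V' ⊗ W')
    (f : V -> W -> V' -> W' -> Z) :
  \tsum_(a, b <- s) \tsum_(c, d <- t) f a b c d =
  \tsum_(c, d <- t) \tsum_(a, b <- s) f a b c d.
Proof. exact: exchange_big. Qed.

Lemma tsumN (t : V ⊗ W) (f : V -> W -> Z) :
  tsum t (fun a b => - f a b) = - tsum t f.
Proof. exact: sumrN. Qed.

Lemma tsumB (t : V ⊗ W) (f h : V -> W -> Z) :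
  tsum t (fun a b => f a b - h a b) = tsum t f - tsum t h.
Proof. by rewrite tsumD tsumN. Qed.

Lemma tsum_tensE (t : V ⊗ W) : tsum t (fun v w => v ⊗ w) = t.
Proof. by rewrite [RHS]tens_sumE. Qed.

Lemma tsum_add s t (f : V -> W -> Z) : bilin f ->
  tsum (s + t) f = tsum s f + tsum t f.
Proof. by move=> bf; rewrite (linD (tsum_linear bf)). Qed.

Lemma tsum_opp t (f : V -> W -> Z) : bilin f -> tsum (- t) f = - tsum t f.
Proof. by move=> bf; rewrite (linN (tsum_linear bf)). Qed.

Lemma tsum_scale k t (f : V -> W -> Z) : bilin f -> tsum (k *: t) f = k *: tsum t f.
Proof. by move=> bf; rewrite (linZ (tsum_linear bf)). Qed.

End TsumRules.

Definition trilin (K : fieldType) (U V W Z : lmodType K) (f : U -> V -> W -> Z) :=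
  [/\ forall v w, linear (fun u => f u v w), forall u w, linear (fun v => f u v w)
    & forall u v, linear (f u v)].

Lemma counitU_scalar (K : fieldType) (g : lieAlgType K) : scalar (@counitU K g).
Proof.
by apply: charU_linear => [k x y|//]; rewrite mulr0 addr0.
Qed.

Lemma delta_g_scalar (K : fieldType) (g : lieAlgType K)
    (X : (\dim {:g}).-tuple g) : basis_of {:g} X -> scalar (delta_g X).
Proof.
by move=> hX; exact: charU_linear (tr_ad_scalar X) (tr_ad_bracket hX).
Qed.

(** A [tsum] runs over a chosen list of pure tensors, so it may be split along sums or evaluated on
    [v ⊗ w] only for a bilinear summand; most rewritings below leave such an obligation. The tactic
    descends through the body of the map one head symbol at a time. Local functions are handled by
    [linear], [bilin] or [trilin] hypotheses in the context, which is why many proofs open by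
    recording them. *)
Ltac lin :=
  cbv beta;
  try match goal with
    |- GRing.linear_for ?s ?f => change (GRing.linear_for s (fun x => f x)); cbv beta
  end;
  lazymatch goal with
  | |- bilin _ => split=> ?; lin
  | |- trilin _ => split=> ? ?; lin
  | |- forall _, _ => move=> ?; lin
  | |- _ =>
  first [ assumption | exact: lin_id |
  match goal with
  | |- GRing.linear_for _ (fun x => @?a x + @?b x) =>
      apply: (@lin_add _ _ _ a b); lin
  | |- GRing.linear_for _ (fun x => - @?a x) => apply: (@lin_opp _ _ _ a); lin
  | |- GRing.linear_for _ (fun x => ?k *: @?a x) => apply: (@lin_scale _ _ _ k a); lin
  | |- GRing.linear_for _ (fun x => @?a x *: ?v) => apply: (@lin_scalel _ _ _ a v); lin
  | |- GRing.linear_for _ (fun x => @?a x ⊗ ?b) =>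
      apply: (@lin_comp _ _ _ _ (fun y => y ⊗ b) a);
      [exact: ((tens_bilin _ _).1 b) | lin]
  | |- GRing.linear_for _ (fun x => ?b ⊗ @?a x) =>
      apply: (@lin_comp _ _ _ _ (fun y => b ⊗ y) a);
      [exact: ((tens_bilin _ _).2 b) | lin]
  | |- GRing.linear_for _ (fun x => tsum (@?a x) ?f) =>
      apply: (@lin_comp _ _ _ _ (fun y => tsum y f) a);
      [apply: tsum_linear; lin | lin]
  | |- GRing.linear_for _ (fun x => tsum ?t (@?f x)) =>
      apply: (@tsum_linear_param _ _ _ _ _ f t); lin
  | |- GRing.linear_for _ (fun x => comul (@?a x)) =>
      apply: (@lin_comp _ _ _ _ comul a); [exact: comul_linear | lin]
  | |- GRing.linear_for _ (fun x => antipode (@?a x)) =>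
      apply: (@lin_comp _ _ _ _ antipode a); [exact: antipode_linear | lin]
  | |- GRing.linear_for _ (fun x => counit (@?a x)) =>
      apply: (@scalar_comp _ _ _ counit a); [exact: counit_scalar | lin]
  | |- GRing.linear_for _ (fun x => comulU (@?a x)) =>
      apply: (@lin_comp _ _ _ _ (@comulU _ _) a); [exact: comulU_linear | lin]
  | |- GRing.linear_for _ (fun x => antipodeU (@?a x)) =>
      apply: (@lin_comp _ _ _ _ (@antipodeU _ _) a); [exact: antipodeU_linear | lin]
  | |- GRing.linear_for _ (fun x => uact (ind_act ?I) (@?a x) ?m) =>
      apply: (@lin_comp _ _ _ _ (fun y => uact (ind_act I) y m) a);
      [exact: ((uact_bilin (ind_act_lie I)).1 m) | lin]
  | |- GRing.linear_for _ (fun x => uact (ind_act ?I) ?u (@?a x)) =>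
      apply: (@lin_comp _ _ _ _ (uact (ind_act I) u) a);
      [exact: ((uact_bilin (ind_act_lie I)).2 u) | lin]
  | |- GRing.linear_for _ (fun x => ind_coact ?I (@?a x)) =>
      apply: (@lin_comp _ _ _ _ (ind_coact I) a);
      [by case: (ind_coact_comod I) | lin]
  | |- GRing.linear_for _ (fun x => uactF ?A (@?a x) ?m) =>
      apply: (@lin_comp _ _ _ _ (fun y => uactF A y m) a);
      [exact: ((uact_bilin (gact_lie A)).1 m) | lin]
  | |- GRing.linear_for _ (fun x => uactF ?A ?u (@?a x)) =>
      apply: (@lin_comp _ _ _ _ (uactF A u) a);
      [exact: ((uact_bilin (gact_lie A)).2 u) | lin]
  | |- GRing.linear_for _ (fun x => gact ?A (@?a x) ?m) =>
      apply: (@lin_comp _ _ _ _ (fun y => gact A y m) a);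
      [exact: ((gact_lie A).1.1 m) | lin]
  | |- GRing.linear_for _ (fun x => gact ?A ?u (@?a x)) =>
      apply: (@lin_comp _ _ _ _ (gact A u) a);
      [exact: ((gact_lie A).1.2 u) | lin]
  | |- GRing.linear_for _ (fun x => gcoact ?A (@?a x)) =>
      apply: (@lin_comp _ _ _ _ (gcoact A) a);
      [by case: (gcoact_comod A) | lin]
  | |- GRing.linear_for _ (fun x => coactU ?A (@?a x)) =>
      apply: (@lin_comp _ _ _ _ (coactU A) a); [apply: coactU_linear; assumption | lin]
  | |- GRing.linear_for _ (fun x => \tr (ad_mx ?X (@?a x))) =>
      apply: (@scalar_comp _ _ _ (fun y => \tr (ad_mx X y)) a);
      [exact: tr_ad_scalar | lin]
  | |- GRing.linear_for _ (fun x => delta_g ?X (@?a x)) =>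
      apply: (@scalar_comp _ _ _ (delta_g X) a);
      [apply: delta_g_scalar; assumption | lin]
  | |- GRing.linear_for _ (fun x => counitU (@?a x)) =>
      apply: (@scalar_comp _ _ _ (@counitU _ _) a); [exact: counitU_scalar | lin]
  | |- GRing.linear_for _ (fun x => @?a x * ?b) =>
      first [ apply: (@lin_comp _ _ _ _ (fun y => y * b) a);
              [exact: lin_mull | lin]
            | apply: (@scalar_mull _ _ a b); lin ]
  | |- GRing.linear_for _ (fun x => ?b * @?a x) =>
      first [ apply: (@lin_comp _ _ _ _ (fun y => b * y) a);
              [exact: lin_mulr | lin]
            | apply: (@scalar_mulr _ _ a b); lin ]
  | H : linear ?f |- GRing.linear_for _ (fun x => ?f (@?a x)) =>
      apply: (@lin_comp _ _ _ _ f a); [exact: H | lin]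
  | H : bilin ?f |- GRing.linear_for _ (fun x => ?f (@?a x) ?b) =>
      apply: (@lin_comp _ _ _ _ (fun y => f y b) a); [exact: (H.1 b) | lin]
  | H : bilin ?f |- GRing.linear_for _ (fun x => ?f ?b (@?a x)) =>
      apply: (@lin_comp _ _ _ _ (fun y => f b y) a); [exact: (H.2 b) | lin]
  | H : trilin ?f |- GRing.linear_for _ (fun x => ?f (@?a x) ?b ?c) =>
      apply: (@lin_comp _ _ _ _ (fun y => f y b c) a);
      [by case: H => H _ _; exact: H | lin]
  | H : trilin ?f |- GRing.linear_for _ (fun x => ?f ?b (@?a x) ?c) =>
      apply: (@lin_comp _ _ _ _ (fun y => f b y c) a);
      [by case: H => _ H _; exact: H | lin]
  | H : trilin ?f |- GRing.linear_for _ (fun x => ?f ?b ?c (@?a x)) =>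
      apply: (@lin_comp _ _ _ _ (fun y => f b c y) a);
      [by case: H => _ _ H; exact: H | lin]
  end ]
  end.

(** * The tensor product of commutative algebras *)

Section TensorRing.
Variables (K : fieldType) (B C : comAlgType K).
Implicit Types s t u : B ⊗ C.

Definition tens_mul s t : B ⊗ C :=
  \tsum_(a, b <- s) \tsum_(c, d <- t) a * c ⊗ b * d.

Lemma tens_mul_bilin : bilin tens_mul.
Proof. by rewrite /tens_mul; lin. Qed.

Lemma tens_mulE (a c : B) (b d : C) : tens_mul (a ⊗ b) (c ⊗ d) = a * c ⊗ b * d.
Proof. by rewrite /tens_mul !tsum_tens //; lin. Qed.

Lemma tens_mulA : associative tens_mul.
Proof.
have bm := tens_mul_bilin.
move=> s t u; move: s; apply: lin_tens_ext; [by lin|by lin|move=> a b].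
move: t; apply: lin_tens_ext; [by lin|by lin|move=> c d].
move: u; apply: lin_tens_ext; [by lin|by lin|move=> e f].
by rewrite !tens_mulE !mulrA.
Qed.

Lemma tens_mulC : commutative tens_mul.
Proof.
have bm := tens_mul_bilin.
move=> s t; move: s; apply: lin_tens_ext; [by lin|by lin|move=> a b].
move: t; apply: lin_tens_ext; [by lin|by lin|move=> c d].
by rewrite !tens_mulE mulrC [b * d]mulrC.
Qed.

Lemma tens_mul1 : left_id (1 ⊗ 1) tens_mul.
Proof.
have bm := tens_mul_bilin.
apply: lin_tens_ext; [by lin|by lin|move=> a b].
by rewrite tens_mulE !mul1r.
Qed.

Lemma tens_mulDl : left_distributive tens_mul +%R.
Proof. by move=> s t u; rewrite (linD (tens_mul_bilin.1 u)). Qed.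

(** Determinants can now be taken over [F ⊗ F], and [comul] is a ring morphism into it; this is how
    [sigmaF] is shown to be grouplike. *)
HB.instance Definition _ := GRing.Zmodule_isComPzRing.Build (tensor B C)
  tens_mulA tens_mulC tens_mul1 tens_mulDl.

End TensorRing.

(** * Commutative Hopf algebras *)

Section Antipode.
Variables (K : fieldType) (F : comHopfAlgType K) (Z : lmodType K).
Implicit Types (f h k : F).

(** The trilinear [E] induces a linear map on [F ⊗ (F ⊗ F)], the nested sum through [T]; it is
    applied to both sides of coassociativity. *)
Lemma tsum_comul_assoc (E : F -> F -> F -> Z) h : trilin E ->
  \tsum_(h1, h2 <- comul h) \tsum_(a, b <- comul h1) E a b h2 =
  \tsum_(h1, h2 <- comul h) \tsum_(a, b <- comul h2) E h1 a b.
Proof.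
move=> tE; pose T a (t : F ⊗ F) := tsum t (E a).
have bT : bilin T by rewrite /T; lin.
have := congr1 (fun t => tsum t T) (comul_assoc h).
rewrite tsum_tsum // => e.
rewrite [RHS](_ : _ = \tsum_(h1, h2 <- comul h) T h1 (comul h2)) //.
rewrite tsum_tsum // in e.
under [RHS]tsum_eq => h1 h2 do rewrite -[T _ _](tsum_tens _ _ bT).
rewrite -e; apply: tsum_eq => h1 h2; rewrite tsum_tsum //; apply: tsum_eq => a b.
by rewrite tsum_tens // /T tsum_tens //; lin.
Qed.

Lemma tsum_counitl (E : F -> Z) h : linear E ->
  \tsum_(h1, h2 <- comul h) counit h1 *: E h2 = E h.
Proof.
move=> lE; rewrite -[in RHS](comul_counitl h) (lin_tsum _ _ lE).
by apply: tsum_eq => a b; rewrite (linZ lE).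
Qed.

Lemma tsum_counitr (E : F -> Z) h : linear E ->
  \tsum_(h1, h2 <- comul h) counit h2 *: E h1 = E h.
Proof.
move=> lE; rewrite -[in RHS](comul_counitr h) (lin_tsum _ _ lE).
by apply: tsum_eq => a b; rewrite (linZ lE).
Qed.

End Antipode.

(** Uniqueness of inverses in the convolution algebra of linear maps from [F] to [B]: a left inverse
    [p] and a right inverse [r] of [q] agree, as [p = p * (q * r) = (p * q) * r = r]. *)
Lemma convolution_inverse_unique (K : fieldType) (F : comHopfAlgType K)
    (B : lmodType K) (m : B -> B -> B) (e : B) (p q r : F -> B) :
    bilin m -> associative m -> left_id e m -> right_id e m ->
    linear p -> linear q -> linear r ->
    (forall h, \tsum_(h1, h2 <- comul h) m (p h1) (q h2) = counit h *: e) ->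
    (forall h, \tsum_(h1, h2 <- comul h) m (q h1) (r h2) = counit h *: e) ->
  p =1 r.
Proof.
move=> bm mA m1 m2 lp lq lr pq qr h.
have := @tsum_comul_assoc _ F B (fun a b c => m (m (p a) (q b)) (r c)) h.
have -> : \tsum_(h1, h2 <- comul h) \tsum_(a, b <- comul h1)
    m (m (p a) (q b)) (r h2) = r h.
  rewrite -[RHS](@tsum_counitl _ _ _ r) //; apply: tsum_eq => h1 h2.
  rewrite -(lin_tsum (fun a b => m (p a) (q b)) _ (bm.1 (r h2))) pq.
  by rewrite (linZ (bm.1 _)) m1.
move->; last by lin.
rewrite -[LHS](@tsum_counitr _ _ _ p) //; apply: tsum_eq => h1 h2.
under tsum_eq => a b do rewrite -mA.
rewrite -(lin_tsum (fun a b => m (q a) (r b)) _ (bm.2 _)) qr.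
by rewrite (linZ (bm.2 _)) m2.
Qed.

Section AntipodeFacts.
Variables (K : fieldType) (F : comHopfAlgType K).
Implicit Types (f h k : F).

Lemma antipode1 : antipode (1 : F) = 1.
Proof.
have := @antipodel K F 1.
rewrite comul1 counit1 tsum_tens; last by lin.
by rewrite mulr1 scale1r.
Qed.

Lemma counit_antipode h : counit (antipode h) = counit h.
Proof.
have /(congr1 counit) := antipodel h.
rewrite (linZ (@counit_scalar K F : linear (counit : F -> K^o))).
rewrite counit1 [RHS]mulr1 => <-.
rewrite -[in LHS](comul_counitr h).
rewrite (lin_tsum _ _ (@antipode_linear K F)).
rewrite !(lin_tsum _ _ (@counit_scalar K F : linear (counit : F -> K^o))).
apply: (@tsum_eq _ _ _ K^o) => a b; rewrite counitM (linZ (@antipode_linear K F)).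
by rewrite (linZ (@counit_scalar K F : linear (counit : F -> K^o))) [LHS]mulrC.
Qed.

Lemma comul_mul h k : comul (h * k) = comul h * comul k.
Proof. exact: comulM. Qed.

Lemma tens_mulrE (a b c d : F) : (a ⊗ b) * (c ⊗ d) = a * c ⊗ b * d.
Proof. exact: tens_mulE. Qed.

(** For convolution of maps into [F ⊗ F], the left side is a left inverse of [comul] and the right
    side is a right inverse. *)
Lemma comul_antipode h : comul (antipode h) =
  \tsum_(h1, h2 <- comul h) antipode h2 ⊗ antipode h1.
Proof.
have bm := @tens_mul_bilin K F F.
pose r (h : F) := \tsum_(h1, h2 <- comul h) antipode h2 ⊗ antipode h1.
apply: (@convolution_inverse_unique K F _ (@tens_mul K F F) 1
  (fun h => comul (antipode h)) (fun h => comul h) r) => //.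
- exact: tens_mulA.
- exact: tens_mul1.
- by move=> s; rewrite tens_mulC tens_mul1.
- by lin.
- by lin.
- by rewrite /r; lin.
- move=> {}h; transitivity (comul (\tsum_(h1, h2 <- comul h) antipode h1 * h2)).
    rewrite (lin_tsum _ _ (@comul_linear K F)); apply: tsum_eq => a b.
    by rewrite comul_mul.
  by rewrite antipodel (linZ (@comul_linear K F)) comul1.
move=> {}h.
rewrite -[1]/(1 ⊗ 1).
transitivity (\tsum_(h1, h2 <- comul h) \tsum_(a, b <- comul h1)
  \tsum_(c, d <- comul h2) a * antipode d ⊗ b * antipode c).
  apply: tsum_eq => h1 h2.
  rewrite (lin_tsum _ _ (bm.2 _)) /r; under tsum_eq => c d.
    rewrite -[comul h1]tsum_tensE (lin_tsum _ _ (bm.1 _)).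
    by under tsum_eq => a b do rewrite tens_mulE; over.
  exact: tsum_exchange.
(* The four legs form h_(1) S(h_(4)) ⊗ h_(2) S(h_(3)). They are regrouped so that the inner pair
   collapses to a counit first, after which the outer pair becomes adjacent. *)
transitivity (\tsum_(h1, h2 <- comul h) \tsum_(a, b <- comul h2)
  \tsum_(c, d <- comul b) h1 * antipode d ⊗ a * antipode c).
  by apply: (@tsum_comul_assoc _ _ _ (fun a b c =>
    \tsum_(c, d <- comul c) a * antipode d ⊗ b * antipode c)); lin.
transitivity (\tsum_(h1, h2 <- comul h) h1 * antipode h2 ⊗ (1 : F)).
  apply: tsum_eq => h1 h2.
  rewrite -(@tsum_comul_assoc _ _ _
    (fun a b c => h1 * antipode c ⊗ a * antipode b)); last by lin.
  rewrite -[RHS](@tsum_counitl _ _ _ (fun h2 => h1 * antipode h2 ⊗ 1)); last by lin.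
  apply: tsum_eq => a b.
  rewrite -(lin_tsum _ _ ((tens_bilin F F).2 _)) antipoder.
  by rewrite tensZr.
rewrite -(lin_tsum _ _ ((tens_bilin F F).1 _)) antipoder.
by rewrite tensZl.
Qed.

(** [E] assembles S(h_(1) k_(1)) (h_(2) k_(2)) (S(h_(3)) S(k_(3))). Contracting the first two
    factors leaves S(h) S(k); contracting the last two, with commutativity to pair each leg with its
    antipode, leaves S(h k). *)
Lemma antipodeM h k : antipode (h * k) = antipode h * antipode k.
Proof.
pose E (a b c : F) := \tsum_(k1, k2 <- comul k) \tsum_(k21, k22 <- comul k2)
  antipode (a * k1) * (b * k21) * (antipode c * antipode k22).
have tE : trilin E by rewrite /E; lin.
have := tsum_comul_assoc h tE.
have -> : \tsum_(h1, h2 <- comul h) \tsum_(a, b <- comul h1) E a b h2 =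
    antipode h * antipode k.
  rewrite -[RHS](@tsum_counitl _ _ _ (fun h => antipode h * antipode k)); last by lin.
  apply: tsum_eq => h1 h2.
  transitivity (\tsum_(k1, k2 <- comul k) \tsum_(k11, k12 <- comul k1)
    \tsum_(a, b <- comul h1)
      antipode (a * k11) * (b * k12) * (antipode h2 * antipode k2)).
    rewrite /E tsum_exchange.
    under tsum_eq => k1 k2 do rewrite tsum_exchange.
    rewrite -(@tsum_comul_assoc _ _ _ (fun k1 k2 k3 => \tsum_(a, b <- comul h1) 
      antipode (a * k1) * (b * k2) * (antipode h2 * antipode k3))) //; lin.
  rewrite -[X in _ = _ *: (_ * X)](@tsum_counitl _ _ _ antipode); last by lin.
  rewrite (lin_tsum _ _ (lin_mulr _)) -tsumZ; apply: tsum_eq => k1 k2.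
  rewrite -scalerAr scalerA -counitM.
  have e : \tsum_(p, q <- comul (h1 * k1)) antipode p * q = (counit (h1 * k1))%:A.
    exact: antipodel.
  rewrite -[X in _ *: X]mul1r scalerAl -e comulM tsum_tsum; last by lin.
  rewrite tsum_exchange (lin_tsum _ _ (lin_mull _)); apply: tsum_eq => a b.
  rewrite tsum_tsum; last by lin.
  rewrite (lin_tsum _ _ (lin_mull _)); apply: tsum_eq => c d.
  by rewrite tsum_tens //; lin.
move->.
rewrite -[LHS](@tsum_counitr _ _ _ (fun h => antipode (h * k))); last by lin.
apply: tsum_eq => h1 h2.
transitivity (\tsum_(k1, k2 <- comul k) \tsum_(k21, k22 <- comul k2)
   antipode (h1 * k1) * (\tsum_(a, b <- comul h2) a * antipode b) * (k21 * antipode k22)).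
  rewrite /E antipoder.
  rewrite -[in LHS](@tsum_counitr _ _ _ (fun k => antipode (h1 * k))); last by lin.
  rewrite -tsumZ; apply: tsum_eq => k1 k2.
  rewrite -(lin_tsum _ _ (lin_mulr _)) antipoder.
  by rewrite -!scalerAr !mulr1 !scalerA mulrC.
rewrite [RHS]tsum_exchange; apply: tsum_eq => k1 k2.
rewrite [RHS]tsum_exchange; apply: tsum_eq => k21 k22.
rewrite -mulrA (lin_tsum _ _ (lin_mull _)) (lin_tsum _ _ (lin_mulr _)).
apply: tsum_eq => a b; rewrite -!mulrA; congr (_ * (_ * _)).
by rewrite mulrCA.
Qed.

End AntipodeFacts.

(** * The modular element of a g-Hopf algebra *)

Section DerivationDet.
Variables (R : comPzRingType) (D : R -> R).
Hypotheses (DD : {morph D : a b / a + b})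
  (DM : forall a b, D (a * b) = D a * b + a * D b).

Let D0 : D 0 = 0.
Proof. by have /eqP := DD 0 0; rewrite addr0 -subr_eq subrr eq_sym => /eqP. Qed.

Let D1 : D 1 = 0.
Proof. by have /eqP := DM 1 1; rewrite !mulr1 mul1r -subr_eq subrr eq_sym => /eqP. Qed.

Let DN a : D (- a) = - D a.
Proof. by apply/eqP; rewrite -subr_eq0 opprK -DD addNr D0. Qed.

Let D_sum I (r : seq I) (P : pred I) (E : I -> R) :
  D (\sum_(i <- r | P i) E i) = \sum_(i <- r | P i) D (E i).
Proof. exact: (big_morph D DD D0). Qed.

Lemma derivation_prod n (a : 'I_n -> R) :
  D (\prod_i a i) = \sum_k \prod_i (if i == k then D (a i) else a i).
Proof.
elim: n a => [|n IH] a; first by rewrite !big_ord0 D1.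
rewrite big_ord_recl DM IH big_ord_recl; congr (_ + _).
  by rewrite big_ord_recl eqxx.
rewrite mulr_sumr; apply: eq_bigr => k _; rewrite [RHS]big_ord_recl.
by rewrite (negbTE (neq_lift _ _)).
Qed.

(** Jacobi's formula. The product rule differentiates one row at a time, and the cofactors along
    that row do not involve it, so they are those of [B]. *)
Lemma derivation_det n (B : 'M[R]_n) :
  D (\det B) = \sum_i \sum_j D (B i j) * cofactor B i j.
Proof.
pose row_der k : 'M[R]_n := \matrix_(i, j) if i == k then D (B i j) else B i j.
have -> : D (\det B) = \sum_k \det (row_der k).
  rewrite /determinant D_sum exchange_big; apply: eq_bigr => s _.
  have -> : D ((-1) ^+ s * \prod_i B i (s i)) = (-1) ^+ s * D (\prod_i B i (s i)).
    by case: (odd_perm s); rewrite ?mulN1r ?DN ?expr0 ?mul1r ?expr1 ?mulN1r.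
  rewrite derivation_prod mulr_sumr; apply: eq_bigr => k _; congr (_ * _).
  by apply: eq_bigr => i _; rewrite mxE.
apply: eq_bigr => k _; rewrite (expand_det_row _ k); apply: eq_bigr => j _.
rewrite mxE eqxx; congr (_ * (_ * \det _)).
by apply/matrixP => i l; rewrite !mxE eq_sym (negbTE (neq_lift _ _)).
Qed.

End DerivationDet.

Section GHopfFacts.
Variables (K : fieldType) (g : lieAlgType K) (X : (\dim {:g}).-tuple g).
Variables (F : comHopfAlgType K) (A : gHopfAlgebra X F).
Implicit Types (x y : g) (f h : F).

(* Call the two sides P f and Q f.  Expanding
   (x |> h)_(1) S((x |> h)_(2)) = 0 and x0 |> (h_(1) S(h_(2))) = 0 gives
   h_(1) P(h_(2)) = h_(1) Q(h_(2)); convolving with S on the left cancels h_(1). *)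
Lemma antipode_gact x f : antipode (gact A x f) =
  \tsum_(x0, x1 <- gcoact A x) antipode x1 * gact A x0 (antipode f).
Proof.
pose P f := antipode (gact A x f).
pose Q f := \tsum_(x0, x1 <- gcoact A x) antipode x1 * gact A x0 (antipode f).
have lP : linear P by rewrite /P; lin.
have lQ : linear Q by rewrite /Q; lin.
have key h : \tsum_(h1, h2 <- comul h) h1 * P h2 = \tsum_(h1, h2 <- comul h) h1 * Q h2.
  have := antipoder (gact A x h); rewrite gact_counit scale0r gact_comul.
  rewrite tsum_add; last by lin.
  rewrite tsum_tsum; last by lin.
  move/eqP; rewrite addrC addr_eq0 => /eqP e.
  transitivity (\tsum_(h1, h2 <- comul h)
    tsum (h1 ⊗ gact A x h2) (fun a b => a * antipode b)).
    by apply: tsum_eq => a b; rewrite tsum_tens //; lin.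
  rewrite -tsum_tsum; last by lin.
  rewrite e /Q -tsumN.
  transitivity (\tsum_(x0, x1 <- gcoact A x) \tsum_(h1, h2 <- comul h)
     h1 * (antipode x1 * gact A x0 (antipode h2))); last first.
    rewrite tsum_exchange; apply: tsum_eq => a b.
    by rewrite (lin_tsum _ _ (lin_mulr _)).
  apply: tsum_eq => x0 x1; rewrite tsum_tsum; last by lin.
  have := gact1 A x0 => e1.
  have := congr1 (gact A x0) (antipoder h); rewrite (linZ (gact_linear A x0)) e1 scaler0.
  rewrite (lin_tsum _ _ (gact_linear A x0)).
  under tsum_eq => a b do rewrite gact_der.
  rewrite tsumD => /eqP; rewrite addr_eq0 => /eqP e2.
  apply/eqP; rewrite -subr_eq0 -opprD oppr_eq0; apply/eqP.
  have -> : \tsum_(a, b <- comul h)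
        tsum (gact A x0 a ⊗ x1 * b) (fun v w => v * antipode w)
     = antipode x1 * \tsum_(a, b <- comul h) gact A x0 a * antipode b.
    rewrite (lin_tsum _ _ (lin_mulr _)); apply: tsum_eq => a b.
    by rewrite tsum_tens; [rewrite antipodeM mulrCA | lin].
  rewrite e2 (lin_tsum _ _ (lin_opp (@lin_id _ F))) (lin_tsum _ _ (lin_mulr _)).
  by rewrite -tsumD /tsum big1 // => p _; rewrite mulrN [in X in _ + X]mulrCA addNr.
rewrite -[LHS](@tsum_counitl _ _ _ P) // -[RHS](@tsum_counitl _ _ _ Q) //.
have R (T : F -> F) : linear T -> \tsum_(h1, h2 <- comul f) counit h1 *: T h2 =
    \tsum_(h1, h2 <- comul f) antipode h1 * \tsum_(a, b <- comul h2) a * T b.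
  move=> lT.
  transitivity (\tsum_(h1, h2 <- comul f) \tsum_(a, b <- comul h1) antipode a * b * T h2).
    apply: tsum_eq => a b; rewrite -(lin_tsum _ _ (lin_mull _)) antipodel.
    by rewrite -scalerAl mul1r.
  rewrite (@tsum_comul_assoc _ _ _ (fun a b c => antipode a * b * T c)); last by lin.
  apply: tsum_eq => a b; rewrite (lin_tsum _ _ (lin_mulr _)).
  by apply: tsum_eq => c d; rewrite mulrA.
by rewrite !R //; apply: tsum_eq => a b; rewrite key.
Qed.

End GHopfFacts.

(** The morphism laws are bare hypotheses so that it applies to [counit], [comul] and the two
    embeddings of [F] in [F ⊗ F]. *)
Lemma det_map_monoid_morphism (R S : comPzRingType) (phi : R -> S) n (B : 'M_n) :
  {morph phi : a b / a + b} -> phi 1 = 1 -> {morph phi : a b / a * b} ->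
  \det (map_mx phi B) = phi (\det B).
Proof.
move=> fD f1 fM.
have f0 : phi 0 = 0 by have /eqP := fD 0 0; rewrite addr0 -subr_eq subrr eq_sym => /eqP.
have fN : phi (-1) = -1.
  by apply/eqP; rewrite -subr_eq0 opprK -f1 -fD addNr f0.
rewrite /determinant (big_morph phi fD f0); apply: eq_bigr => s _.
rewrite fM (big_morph phi fM f1); congr (_ * _).
  by case: (odd_perm s); rewrite ?expr0 ?expr1.
by apply: eq_bigr => i _; rewrite mxE.
Qed.

Section Modular.
Variables (K : fieldType) (g : lieAlgType K) (X : (\dim {:g}).-tuple g).
Hypothesis hX : basis_of {:g} X.
Variables (F : comHopfAlgType K) (A : gHopfAlgebra X F).
Local Notation n := (\dim {:g}).
Local Notation coef := (coef_mx X (gcoact A)).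
Local Notation sigma := (sigmaF A).
Implicit Types (x y : g) (f h : F).

Let coordX (i j : 'I_n) : coord X i X`_j = (j == i)%:R.
Proof. by rewrite coord_free ?(basis_free hX). Qed.

Let coef_bil (W : lmodType K) (i : 'I_n) : bilin (fun x (w : W) => coord X i x *: w).
Proof.
have l : scalar (coord X i) by move=> k u v; rewrite linearP.
by split=> [w k u v|v]; [rewrite linearP scalerDl scalerA | lin].
Qed.

Let coef_sum (W : lmodType K) (i : 'I_n) (w : 'I_n -> W) :
  \tsum_(x, v <- \sum_(j < n) (X`_j ⊗ w j)) coord X i x *: v = w i.
Proof.
rewrite (lin_sum (tsum_linear (coef_bil W i))) (bigD1 i) //=.
rewrite tsum_tens; last exact: coef_bil.
rewrite coordX eqxx scale1r big1 ?addr0 // => j ne.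
rewrite tsum_tens; last exact: coef_bil.
by rewrite coordX (negbTE ne) scale0r.
Qed.

Lemma counit_coef (i j : 'I_n) : counit (coef i j) = (i == j)%:R.
Proof.
have [_ _ cu] := gcoact_comod A.
have /(congr1 (coord X i)) := cu X`_j.
rewrite (gcoact_basis A hX) (lin_sum (tsum_linear _)); last by lin.
rewrite coordX eq_sym => <-; rewrite linear_sum (bigD1 i) //= tsum_tens; last by lin.
rewrite linearZ /= coordX eqxx mulr1 big1 ?addr0 // => k ne.
rewrite tsum_tens; last by lin.
by rewrite linearZ /= coordX (negbTE ne) mulr0.
Qed.

(** Coassociativity of the coaction on [X_j], read at its [X_i]-component. *)
Lemma comul_coef (i j : 'I_n) : comul (coef i j) = \sum_k (coef i k ⊗ coef k j).
Proof.
have [cl ca _] := gcoact_comod A.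
pose fL (m0 : g) (m1 : F) := \tsum_(m00, m01 <- gcoact A m0) m00 ⊗ (m01 ⊗ m1).
pose fR (m0 : g) (m1 : F) := m0 ⊗ comul m1.
have bL : bilin fL by rewrite /fL; lin.
have bR : bilin fR by rewrite /fR; lin.
have := congr1 (fun t => \tsum_(x, v <- t) coord X i x *: v) (ca X`_j).
rewrite -[X in tsum X _ = _ -> _]/(tsum _ fL) -[X in _ = tsum X _ -> _]/(tsum _ fR).
rewrite (gcoact_basis A hX) (lin_sum (tsum_linear bL)) (lin_sum (tsum_linear bR)).
under [in X in _ = X -> _]eq_bigr => k _ do rewrite tsum_tens // /fR.
rewrite coef_sum => <-.
rewrite (lin_sum (tsum_linear (coef_bil _ i))); apply: eq_bigr => k _.
pose fk (m0 : g) (m1 : F) := m0 ⊗ (m1 ⊗ coef k j).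
have bk : bilin fk by rewrite /fk; lin.
rewrite tsum_tens // /fL -[X in tsum X _]/(tsum _ fk).
rewrite (gcoact_basis A hX) (lin_sum (tsum_linear bk)).
under [X in tsum X _]eq_bigr => l _ do rewrite tsum_tens // /fk.
by rewrite coef_sum.
Qed.

Lemma counit_sigma : counit sigma = 1.
Proof.
rewrite -(@det_map_monoid_morphism F K) ?counit1 //; last first.
- exact: counitM.
- by move=> a b; have := counit_scalar 1 a b; rewrite scale1r mul1r.
rewrite -[RHS](@det1 K n); congr (\det _); apply/matrixP => i j.
by rewrite !mxE -counit_coef mxE.
Qed.

(** By [comul_coef], [comul] sends the coefficient matrix to the product of its images under f |-> f
    ⊗ 1 and f |-> 1 ⊗ f, and the determinant is multiplicative. *)
Lemma comul_sigma : comul sigma = sigma ⊗ sigma.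
Proof.
rewrite -(@det_map_monoid_morphism F (tensor F F)); first last.
- exact: comulM.
- exact: comul1.
- exact: (linD (@comul_linear K F)).
have -> : map_mx (comul : F -> tensor F F) coef =
    map_mx (fun f : F => f ⊗ 1 : tensor F F) coef *m
    map_mx (fun f : F => 1 ⊗ f : tensor F F) coef.
  apply/matrixP => i j; rewrite mxE comul_coef [RHS]mxE; apply: eq_bigr => k _.
  by rewrite !mxE tens_mulrE mulr1 mul1r.
rewrite det_mulmx !det_map_monoid_morphism //.
- by rewrite tens_mulrE mulr1 mul1r.
- by move=> a b; rewrite tensDr.
- by move=> a b; rewrite tens_mulrE mulr1.
- by move=> a b; rewrite tensDl.
- by move=> a b; rewrite tens_mulrE mulr1.
Qed.

End Modular.

(** * Derivatives of the modular element *)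

Section ModularIdentity.
Variables (K : fieldType) (g : lieAlgType K) (X : (\dim {:g}).-tuple g).
Hypothesis hX : basis_of {:g} X.
Variables (F : comHopfAlgType K) (A : gHopfAlgebra X F).
Local Notation n := (\dim {:g}).
Local Notation c := (coef_mx X (gcoact A)).
Local Notation sigma := (sigmaF A).
Local Notation tr_ad x := (\tr (ad_mx X x)).
Let s : 'M[F]_n := map_mx antipode c.
Let D (i : 'I_n) : F -> F := gact A X`_i.

(** Since [comul] acts on the entries of [c] as matrix multiplication, the antipode axioms say that
    [s] is the inverse matrix of [c]. *)
Let antipode_coef_l : s *m c = 1%:M.
Proof.
apply/matrixP => i j; rewrite !mxE.
have := antipodel (c i j); rewrite (comul_coef hX) (lin_sum (tsum_linear _)); last by lin.
rewrite (counit_coef hX) scaler_nat => <-; apply: eq_bigr => k _.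
by rewrite mxE tsum_tens //; lin.
Qed.

Let antipode_coef_r : c *m s = 1%:M.
Proof.
apply/matrixP => i j; rewrite !mxE.
have := antipoder (c i j); rewrite (comul_coef hX) (lin_sum (tsum_linear _)); last by lin.
rewrite (counit_coef hX) scaler_nat => <-; apply: eq_bigr => k _.
by rewrite [s _ _]mxE tsum_tens //; lin.
Qed.

Let sum_sc i j : \sum_k s i k * c k j = (i == j)%:R.
Proof. by move/matrixP/(_ i j): antipode_coef_l; rewrite !mxE. Qed.

Let sum_cs i j : \sum_k c i k * s k j = (i == j)%:R.
Proof. by move/matrixP/(_ i j): antipode_coef_r; rewrite !mxE. Qed.

Let DD i : {morph D i : a b / a + b}.
Proof. exact: linD (gact_linear A _). Qed.

(** The derivative of an inverse matrix, [- s D(c) s], from differentiating [c s = 1]. *)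
Let gact_antipode_coef (k i j : 'I_n) :
  D k (s i j) = - \sum_a \sum_b s i a * D k (c a b) * s b j.
Proof.
have l := gact_linear A X`_k.
have e a : \sum_b D k (c a b) * s b j = - \sum_b c a b * D k (s b j).
  apply/eqP; rewrite -addr_eq0 -big_split /=.
  under eq_bigr => b _ do rewrite -gact_der.
  rewrite -(lin_sum l) sum_cs; case: (a == j); last by rewrite (lin0 l).
  by rewrite gact1.
under eq_bigr => a _.
  under eq_bigr => b _ do rewrite -mulrA.
  rewrite -mulr_sumr e mulrN; over.
rewrite sumrN opprK; under eq_bigr => a _ do rewrite mulr_sumr.
rewrite exchange_big (bigD1 i) //= [X in _ + X]big1 => [|b ne].
  under eq_bigr => a _ do rewrite mulrA.
  by rewrite -mulr_suml sum_sc eqxx mul1r addr0.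
under eq_bigr => a _ do rewrite mulrA.
by rewrite -mulr_suml sum_sc eq_sym (negbTE ne) mul0r.
Qed.

Let cofactor_coef (i j : 'I_n) : cofactor c i j = sigma * s j i.
Proof.
have -> : cofactor c i j = (\adj c) j i by rewrite mxE.
by rewrite -[\adj c]mulmx1 -antipode_coef_r mulmxA mul_adj_mx mul_scalar_mx mxE.
Qed.

(** Jacobi's formula with the adjugate written as [sigma s]; the double sum is the trace of
    [D(c) c^-1], the logarithmic derivative of the determinant. *)
Let gact_sigma (i : 'I_n) : D i sigma = sigma * \sum_k \sum_l D i (c k l) * s l k.
Proof.
rewrite /sigmaF (derivation_det (DD i) (gact_der A X`_i)) mulr_sumr.
apply: eq_bigr => k _; rewrite mulr_sumr; apply: eq_bigr => l _.
by rewrite cofactor_coef mulrCA.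
Qed.

(** Both entries of [c] cancel against [s], forcing [p = a] and [q = j]. What remains is the sum
    over a of C^a_{a,j}, and antisymmetry of the bracket gives the sign. *)
Let quad_term (j : 'I_n) :
  \sum_i \sum_a \sum_b s i a *
    (\sum_p \sum_q struct_const X p q a *: (c q b * c p i)) * s b j
  = - (tr_ad X`_j)%:A.
Proof.
transitivity (\sum_a \sum_p \sum_q struct_const X p q a *:
   ((\sum_i c p i * s i a) * (\sum_b c q b * s b j))).
  rewrite exchange_big; apply: eq_bigr => a _.
  transitivity (\sum_i \sum_b \sum_p \sum_q
     struct_const X p q a *: ((c p i * s i a) * (c q b * s b j))).
    apply: eq_bigr => i _; apply: eq_bigr => b _.
    rewrite mulr_sumr mulr_suml; apply: eq_bigr => p _.
    rewrite mulr_sumr mulr_suml; apply: eq_bigr => q _.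
    rewrite -scalerAr -scalerAl; congr (_ *: _).
    rewrite [s i a * _]mulrC -!mulrA [LHS]mulrCA; congr (_ * _).
    by rewrite mulrCA.
  under eq_bigr => i _ do rewrite exchange_big.
  rewrite exchange_big; apply: eq_bigr => p _.
  under eq_bigr => i _ do rewrite exchange_big.
  rewrite exchange_big; apply: eq_bigr => q _.
  rewrite mulr_suml scaler_sumr; apply: eq_bigr => i _.
  by rewrite mulr_sumr scaler_sumr.
rewrite /mxtrace -[RHS]scaleNr -sumrN scaler_suml; apply: eq_bigr => a _.
rewrite (bigD1 a) //= [X in _ + X]big1 => [|p ne]; last first.
  by rewrite big1 // => q _; rewrite [X in X * _]sum_cs (negbTE ne) mul0r scaler0.
rewrite (bigD1 j) //= [X in _ + X + _]big1 => [|q ne]; last first.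
  by rewrite [X in _ * X]sum_cs (negbTE ne) mulr0 scaler0.
rewrite !sum_cs !eqxx mulr1 !addr0; congr (_ *: _).
by rewrite struct_constC mxE.
Qed.

(** Here only one factor [s] cancels, forcing [l = i]; the sum over i of C^i_{b,i} is the trace of
    ad X_b. *)
Let lin_term (j : 'I_n) :
  \sum_i \sum_a \sum_b s i a * (\sum_l struct_const X b i l *: c a l) * s b j
  = \sum_(b < n) tr_ad X`_b *: s b j.
Proof.
transitivity (\sum_b \sum_i \sum_l struct_const X b i l *:
   ((\sum_a s i a * c a l) * s b j)).
  under eq_bigr => i _ do rewrite exchange_big.
  rewrite exchange_big; apply: eq_bigr => b _; apply: eq_bigr => i _.
  under eq_bigr => a _ do rewrite mulr_sumr mulr_suml.
  rewrite exchange_big; apply: eq_bigr => l _.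
  rewrite mulr_suml scaler_sumr; apply: eq_bigr => a _.
  by rewrite -scalerAr -scalerAl.
apply: eq_bigr => b _; rewrite /mxtrace scaler_suml; apply: eq_bigr => i _.
rewrite (bigD1 i) //= [X in _ + X]big1 => [|l ne]; last first.
  by rewrite sum_sc eq_sym (negbTE ne) mul0r scaler0.
by rewrite sum_sc eqxx mul1r addr0 [ad_mx _ _ _ _]mxE.
Qed.

Let gact_sigma_antipode_coef (j : 'I_n) :
  \sum_i D i (s i j * sigma) =
  \sum_(i < n) tr_ad X`_i *: (s i j * sigma) - tr_ad X`_j *: sigma.
Proof.
(* The parts with [D i sigma] and with [D i (s i j)] have the same shape once summation indices are
   renamed, with opposite signs; so derivatives of [c] occur antisymmetrised, as in the structure
   identity. *)
have -> : \sum_i D i (s i j * sigma) = sigma *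
    (\sum_i \sum_a \sum_b s i a * (D b (c a i) - D i (c a b)) * s b j).
  transitivity (sigma * (\sum_b \sum_a \sum_i s i a * D b (c a i) * s b j
      - \sum_i \sum_a \sum_b s i a * D i (c a b) * s b j)); last first.
    congr (_ * _); rewrite [X in X - _]exchange_big.
    under [X in X - _]eq_bigr => a _ do rewrite exchange_big.
    rewrite [X in X - _]exchange_big -sumrB.
    apply: eq_bigr => i _; rewrite -sumrB; apply: eq_bigr => a _; rewrite -sumrB.
    by apply: eq_bigr => b _; rewrite mulrBr mulrBl.
  rewrite mulrBr [X in X - _]mulr_sumr [X in _ - X]mulr_sumr -sumrB.
  apply: eq_bigr => i _; rewrite /D gact_der addrC; congr (_ + _).
    rewrite -/(D i _) gact_sigma mulrCA mulr_sumr; congr (_ * _).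
    apply: eq_bigr => a _; rewrite mulr_sumr; apply: eq_bigr => b _.
    by rewrite [RHS]mulrC; congr (_ * _); rewrite mulrC.
  by rewrite -/(D i _) gact_antipode_coef mulrC mulrN.
transitivity (sigma * (- (tr_ad X`_j)%:A + \sum_(b < n) tr_ad X`_b *: s b j)).
  congr (_ * _); rewrite -quad_term -lin_term -big_split; apply: eq_bigr => i _.
  rewrite -big_split; apply: eq_bigr => a _; rewrite -big_split.
  by apply: eq_bigr => b _; rewrite gcoact_struct mulrDr mulrDl.
rewrite addrC mulrBr -scalerAr mulr1; congr (_ - _).
rewrite mulr_sumr; apply: eq_bigr => b _.
by rewrite -scalerAr mulrC.
Qed.

(* In a basis, the left side is computed by Jacobi's formula for X_i |> det f and
   by differentiating S(f) f = 1; the structure identity of the g-Hopf algebra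
   turns the antisymmetrised derivatives of f into traces of ad. *)
Lemma gact_antipode_sigma x :
  \tsum_(x0, x1 <- gcoact A x) gact A x0 (antipode x1 * sigma) =
  \tsum_(x0, x1 <- gcoact A x) tr_ad x0 *: (antipode x1 * sigma) - tr_ad x *: sigma.
Proof.
pose bl (x0 : g) (x1 : F) := gact A x0 (antipode x1 * sigma).
pose br (x0 : g) (x1 : F) := tr_ad x0 *: (antipode x1 * sigma).
have Bl : bilin bl by rewrite /bl; lin.
have Br : bilin br by rewrite /br; lin.
pose L x := tsum (gcoact A x) bl.
pose R x := tsum (gcoact A x) br - tr_ad x *: sigma.
have lL : linear L by rewrite /L; lin.
have lR : linear R by rewrite /R; lin.
rewrite -[LHS]/(L x) -[RHS]/(R x) (basisE hX x) (lin_sum lL) (lin_sum lR).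
apply: eq_bigr => j _; rewrite (linZ lL) (linZ lR); congr (_ *: _).
rewrite /L /R (gcoact_basis A hX) (lin_sum (tsum_linear Bl)) (lin_sum (tsum_linear Br)).
have := gact_sigma_antipode_coef j; rewrite -/(sigmaF A).
under eq_bigr => i _ do rewrite [s i j]mxE.
under [in X in _ = X -> _]eq_bigr => i _ do rewrite [s i j]mxE.
by under eq_bigr => i _ do rewrite -[D _ _]/(bl _ _) -(tsum_tens _ _ Bl);
   under [in X in _ = X -> _]eq_bigr => i _ do rewrite -[_ *: _]/(br _ _) -(tsum_tens _ _ Br).
Qed.

End ModularIdentity.

(** * The enveloping algebra and its actions *)

Section Enveloping.
Variables (K : fieldType) (g : lieAlgType K).
Local Notation U := (envalg g).
Implicit Types (x : g) (u v : U).

Lemma tsum_comulU_cons (Z : lmodType K) (E : U -> U -> Z) x u : bilin E ->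
  tsum (comulU (uiota x * u)) E =
  \tsum_(a, b <- comulU u) (E (uiota x * a) b + E a (uiota x * b)).
Proof.
move=> bE; rewrite comulU_cons /comulU_act tsum_tsum //; apply: tsum_eq => a b.
by rewrite tsum_add // !tsum_tens.
Qed.

Lemma tsum_comulUM (Z : lmodType K) (E : U -> U -> Z) u v : bilin E ->
  tsum (comulU (u * v)) E =
  \tsum_(a, b <- comulU u) \tsum_(c, d <- comulU v) E (a * c) (b * d).
Proof.
move=> bE; rewrite comulUM tsum_tsum //; apply: tsum_eq => a b.
by rewrite tsum_tsum //; apply: tsum_eq => c d; rewrite tsum_tens.
Qed.

Lemma tsum_comulU_assoc (Z : lmodType K) (E : U -> U -> U -> Z) u : trilin E ->
  \tsum_(u1, u2 <- comulU u) \tsum_(a, b <- comulU u1) E a b u2 =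
  \tsum_(u1, u2 <- comulU u) \tsum_(a, b <- comulU u2) E u1 a b.
Proof.
elim/envalg_ind: u E => [|k u IH|u v IHu IHv|x u IH] E tE.
- by rewrite comulU1 !tsum_tens ?comulU1 ?tsum_tens //; lin.
- rewrite (linZ (@comulU_linear _ _)) !tsum_scale ?IH //; lin.
- rewrite (linD (@comulU_linear _ _)) !tsum_add ?IHu ?IHv //; lin.
rewrite !tsum_comulU_cons; [|by lin|by lin].
(* A generator acts on the three legs by the Leibniz rule, whichever way they are bracketed. The
   induction hypothesis is applied to [E'], hence the quantification over [E]. *)
pose E' a b c := E (uiota x * a) b c + E a (uiota x * b) c + E a b (uiota x * c).
transitivity (\tsum_(u1, u2 <- comulU u) \tsum_(a, b <- comulU u1) E' a b u2).
  apply: tsum_eq => a b; rewrite tsum_comulU_cons; last by lin.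
  by rewrite -tsumD.
rewrite IH; last by rewrite /E'; lin.
apply: tsum_eq => a b; rewrite tsum_comulU_cons; last by lin.
by rewrite -tsumD; apply: tsum_eq => c d; rewrite addrA.
Qed.

Lemma counitU1 : counitU (1 : U) = 1.
Proof. by apply: charU1 => [k x y|//]; rewrite mulr0 addr0. Qed.

Lemma counitUM u v : counitU (u * v) = counitU u * counitU v.
Proof. by apply: charUM => [k x y|//]; rewrite mulr0 addr0. Qed.

Lemma counitU_gen x : counitU (uiota x) = 0.
Proof. by apply: charU_gen => [k y z|//]; rewrite mulr0 addr0. Qed.

Lemma tsum_counitUl (Z : lmodType K) (E : U -> Z) u : linear E ->
  \tsum_(u1, u2 <- comulU u) counitU u1 *: E u2 = E u.
Proof.
elim/envalg_ind: u E => [|k u IH|u v IHu IHv|x u IH] E lE.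
- by rewrite comulU1 tsum_tens ?counitU1 ?scale1r //; lin.
- by rewrite (linZ (@comulU_linear _ _)) tsum_scale ?IH ?(linZ lE) //; lin.
- by rewrite (linD (@comulU_linear _ _)) tsum_add ?IHu ?IHv ?(linD lE) //; lin.
rewrite tsum_comulU_cons; last by lin.
rewrite -(IH (fun u => E (uiota x * u))); last by lin.
by apply: tsum_eq => a b; rewrite counitUM counitU_gen mul0r scale0r add0r.
Qed.

End Enveloping.

Section ModuleAlgebra.
Variables (K : fieldType) (g : lieAlgType K) (X : (\dim {:g}).-tuple g).
Variables (F : comHopfAlgType K) (A : gHopfAlgebra X F).
Local Notation U := (envalg g).
Implicit Types (x : g) (u v : U) (f h : F).

Lemma uactF1 f : uactF A 1 f = f.
Proof. exact: (uact1 (gact_lie A)). Qed.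

Lemma uactF_comp u v f : uactF A (u * v) f = uactF A u (uactF A v f).
Proof. exact: (uactM (gact_lie A)). Qed.

Lemma uactF_gen x f : uactF A (uiota x) f = gact A x f.
Proof. exact: (uact_gen (gact_lie A)). Qed.

Lemma uactFM u f h : uactF A u (f * h) =
  \tsum_(u1, u2 <- comulU u) uactF A u1 f * uactF A u2 h.
Proof.
elim/envalg_ind: u => [|k u IH|u v IHu IHv|x u IH].
- by rewrite comulU1 tsum_tens ?uactF1 //; lin.
- rewrite (linZ (@comulU_linear _ _)) tsum_scale -?IH; last by lin.
  by rewrite /uactF (linZ ((uact_bilin (gact_lie A)).1 _)).
- rewrite (linD (@comulU_linear _ _)) tsum_add -?IHu -?IHv; last by lin.
  by rewrite /uactF (linD ((uact_bilin (gact_lie A)).1 _)).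
rewrite tsum_comulU_cons; last by lin.
rewrite uactF_comp IH uactF_gen (lin_tsum _ _ (gact_linear A x)).
by apply: tsum_eq => a b; rewrite gact_der !uactF_comp !uactF_gen.
Qed.

Lemma counit_uactF u f : counit (uactF A u f) = counitU u * counit f.
Proof.
elim/envalg_ind: u => [|k u IH|u v IHu IHv|x u IH].
- by rewrite uactF1 counitU1 mul1r.
- rewrite /uactF (linZ ((uact_bilin (gact_lie A)).1 _)) -/(uactF A u f).
  rewrite (linZ (@counit_scalar K F : linear (counit : F -> K^o))) IH.
  rewrite (linZ (@counitU_scalar K g : linear (@counitU K g : _ -> K^o))).
  exact: mulrA.
- rewrite /uactF (linD ((uact_bilin (gact_lie A)).1 _)) -!/(uactF A _ f).
  rewrite (linD (@counit_scalar K F : linear (counit : F -> K^o))) IHu IHv.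
  by rewrite (linD (@counitU_scalar K g : linear (@counitU K g : _ -> K^o))) mulrDl.
by rewrite uactF_comp uactF_gen gact_counit counitUM counitU_gen !mul0r.
Qed.

Lemma tsum_coactU_cons (Z : lmodType K) (E : U -> F -> Z) x u :
    basis_of {:g} X -> bilin E ->
  tsum (coactU A (uiota x * u)) E =
  \tsum_(v, f <- coactU A u)
    (\tsum_(x0, x1 <- gcoact A x) E (uiota x0 * v) (x1 * f) + E v (gact A x f)).
Proof.
move=> hX bE; rewrite (coactU_cons A hX) /coactU_act tsum_add // tsumD; congr (_ + _).
  rewrite tsum_tsum //; apply: tsum_eq => v f; rewrite tsum_tsum //.
  by apply: tsum_eq => a b; rewrite tsum_tens.
by rewrite tsum_tsum //; apply: tsum_eq => v f; rewrite tsum_tens.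
Qed.

End ModuleAlgebra.

(** * The right action of the enveloping algebra on M *)

Section RightAction.
Variables (K : fieldType) (g : lieAlgType K) (X : (\dim {:g}).-tuple g).
Hypothesis hX : basis_of {:g} X.
Variables (F : comHopfAlgType K) (A : gHopfAlgebra X F).
Variables (M : lmodType K) (I : induced_module A M).
Local Notation U := (envalg g).
Implicit Types (x : g) (u v : U) (m : M).

Definition twisted_act m u : M :=
  \tsum_(u1, u2 <- comulU u) delta_g X u1 *: uact (ind_act I) (antipodeU u2) m.

Lemma twisted_act_bilin : bilin twisted_act.
Proof. by rewrite /twisted_act; lin. Qed.

Lemma twisted_act1 m : twisted_act m 1 = m.
Proof.
rewrite /twisted_act comulU1 tsum_tens; last by lin.
by rewrite antipodeU1 (uact1 (ind_act_lie I)) (delta_g1 hX) scale1r.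
Qed.

(** The antipode reverses products, turning the left action into a right one, while [delta_g] is
    multiplicative with commuting values. *)
Lemma twisted_actM m u v : twisted_act m (u * v) = twisted_act (twisted_act m u) v.
Proof.
rewrite {1}/twisted_act tsum_comulUM; last by lin.
rewrite tsum_exchange; apply: tsum_eq => c d.
rewrite (lin_tsum _ _ ((uact_bilin (ind_act_lie I)).2 _)) -tsumZ; apply: tsum_eq => a b.
rewrite (linZ ((uact_bilin (ind_act_lie I)).2 _)) scalerA antipodeUM.
by rewrite (uactM (ind_act_lie I)) (delta_gM hX) mulrC.
Qed.

Lemma twisted_act_gen m x :
  twisted_act m (uiota x) = \tr (ad_mx X x) *: m - ind_act I x m.
Proof.
rewrite /twisted_act comulU_gen tsum_add; last by lin.
rewrite !tsum_tens; [|by lin|by lin].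
rewrite antipodeU1 (uact1 (ind_act_lie I)) (delta_g1 hX) (delta_g_gen hX) scale1r.
rewrite antipodeU_gen (linN ((uact_bilin (ind_act_lie I)).1 _)).
by rewrite (uact_gen (ind_act_lie I)).
Qed.

End RightAction.

(** * The anti-Yetter-Drinfeld condition *)

Section AntiYetterDrinfeld.
Variables (K : fieldType) (g : lieAlgType K) (X : (\dim {:g}).-tuple g).
Hypothesis hX : basis_of {:g} X.
Variables (F : comHopfAlgType K) (A : gHopfAlgebra X F).
Variables (M : lmodType K) (I : induced_module A M).
Local Notation U := (envalg g).
Local Notation "m ◁ u" := (twisted_act I m u) (at level 40, left associativity).
Implicit Types (x : g) (u v : U) (f h : F) (m : M).

Let bact : bilin (twisted_act I) := twisted_act_bilin hX I.

(* The product (1 (x) s)(f (x) a) of the bicrossed product, tensored with m. *)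
Definition left_smash (s : U) f (a : U) m : (F ⊗ U) ⊗ M :=
  \tsum_(s1, s2 <- comulU s) (uactF A s1 f ⊗ s2 * a) ⊗ m.

(** The commutation rule x f = (x |> f) + f x of the bicrossed product. It moves the generator that
    [antipodeU] places at the right end of the left factor. *)
Lemma left_smash_consr s x f a m : left_smash (s * uiota x) f a m =
  left_smash s (gact A x f) a m + left_smash s f (uiota x * a) m.
Proof.
rewrite /left_smash tsum_comulUM; last by lin.
rewrite -tsumD; apply: tsum_eq => b c.
rewrite comulU_gen tsum_add; last by lin.
rewrite !tsum_tens; [|by lin|by lin].
by rewrite !mulr1 uactF_comp uactF_gen mulrA.
Qed.

(* S(h_(3)) (f (x) 1) h_(1) (x) m h_(2), where v1, v2, v3 are the legs of the
   iterated coproduct in U(g) of v, for h = 1 (x) v. *)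
Definition ayd_legs f m (v1 v2 v3 : U) : (F ⊗ U) ⊗ M :=
  \tsum_(a, al <- coactU A v1) \tsum_(b, be <- coactU A v2)
  \tsum_(c, ga <- coactU A v3)
    left_smash (antipodeU c) (f * antipode (al * be * ga)) a (m ◁ b).

Definition ayd_rhs v f m : (F ⊗ U) ⊗ M :=
  \tsum_(v1, v23 <- comulU v) \tsum_(v2, v3 <- comulU v23) ayd_legs f m v1 v2 v3.

Lemma ayd_legs_bilin v1 v2 v3 : bilin (fun f m => ayd_legs f m v1 v2 v3).
Proof. by rewrite /ayd_legs /left_smash; lin. Qed.

Lemma ayd_legs_trilin f m : trilin (ayd_legs f m).
Proof. by rewrite /ayd_legs /left_smash; lin. Qed.

Lemma ayd_rhs_bilin v : bilin (ayd_rhs v).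
Proof. by have := ayd_legs_bilin; rewrite /ayd_rhs /ayd_legs /left_smash; lin. Qed.

Lemma ayd_rhs_linear f m : linear (fun v => ayd_rhs v f m).
Proof. by have tl := ayd_legs_trilin f m; rewrite /ayd_rhs; lin. Qed.

(** The three lines on the left are [x] entering h_(1), h_(2) and h_(3). The derivatives of [al],
    [be], [ga] add up to one of their product, which [antipode_gact] rewrites through x_<0> |>
    [phi]. In the third line the generator leaves the antipode with a minus sign and
    [left_smash_consr] splits it: one part cancels the h_(1) term, the other is a derivative of f
    S(x_<1>) [phi] whose part along [phi] cancels the previous derivatives. *)
Let pointwise x f m (a b c : U) (al be ga : F) :
  (\tsum_(x0, x1 <- gcoact A x)
     left_smash (antipodeU c) (f * antipode (x1 * al * be * ga)) (uiota x0 * a) (m ◁ b)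
   + left_smash (antipodeU c) (f * antipode (gact A x al * be * ga)) a (m ◁ b))
  + (\tsum_(x0, x1 <- gcoact A x)
     left_smash (antipodeU c) (f * antipode (al * (x1 * be) * ga)) a (m ◁ (uiota x0 * b))
   + left_smash (antipodeU c) (f * antipode (al * gact A x be * ga)) a (m ◁ b))
  + (\tsum_(x0, x1 <- gcoact A x)
     left_smash (antipodeU (uiota x0 * c)) (f * antipode (al * be * (x1 * ga))) a (m ◁ b)
   + left_smash (antipodeU c) (f * antipode (al * be * gact A x ga)) a (m ◁ b))
  = \tsum_(x0, x1 <- gcoact A x)
     (left_smash (antipodeU c) (f * antipode x1 * antipode (al * be * ga)) a (m ◁ uiota x0 ◁ b)
      - left_smash (antipodeU c)
          (gact A x0 (antipode x1 * f) * antipode (al * be * ga)) a (m ◁ b)).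
Proof.
set phi := antipode (al * be * ga); set s := antipodeU c.
have l2 a' m' : linear (fun f => left_smash s f a' m') by rewrite /left_smash; lin.
have e : left_smash s (f * antipode (gact A x al * be * ga)) a (m ◁ b)
    + left_smash s (f * antipode (al * gact A x be * ga)) a (m ◁ b)
    + left_smash s (f * antipode (al * be * gact A x ga)) a (m ◁ b) =
    \tsum_(x0, x1 <- gcoact A x)
      left_smash s (f * (antipode x1 * gact A x0 phi)) a (m ◁ b).
  rewrite -!(linD (l2 _ _)) -!mulrDr -!(linD (@antipode_linear K F)).
  rewrite -!mulrDl -gact_der -gact_der antipode_gact -/phi.
  by rewrite (lin_tsum _ _ (lin_mulr _)) (lin_tsum _ _ (l2 _ _)).
have shuffle (Z : zmodType) (p q r p' q' r' : Z) :
    (p + p') + (q + q') + (r + r') = (p' + q' + r') + (p + q + r).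
  by rewrite [RHS]addrC (_ : p + p' + (q + q') = p + q + (p' + q')); exact: addrACA.
have antipode_pull (x1 : F) : [/\ antipode (x1 * al * be * ga) = antipode x1 * phi,
    antipode (al * (x1 * be) * ga) = antipode x1 * phi
  & antipode (al * be * (x1 * ga)) = antipode x1 * phi].
  by split; rewrite /phi -antipodeM; congr antipode;
    [rewrite !mulrA | rewrite [al * _]mulrCA -!mulrA | rewrite mulrCA].
rewrite shuffle e -!tsumD; apply: tsum_eq => x0 x1.
have [-> -> ->] := antipode_pull x1.
have l1 f' a' m' : linear (fun s => left_smash s f' a' m') by rewrite /left_smash; lin.
rewrite antipodeU_cons (linN (l1 _ _ _)) left_smash_consr -/s twisted_actM //.
set psi := f * (antipode x1 * phi).
have -> : gact A x0 psi =
    gact A x0 (antipode x1 * f) * phi + f * (antipode x1 * gact A x0 phi).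
  by rewrite /psi !mulrA [f * _]mulrC gact_der.
rewrite (linD (l2 _ _)) -[f * _ * _]mulrA -/psi.
rewrite [X in _ - X]addrC opprD [X in _ + X]addrACA subrr add0r opprD addrCA.
by congr (_ + _); rewrite addrCA subrr addr0.
Qed.

Lemma ayd_rhs_cons v x f m : ayd_rhs (uiota x * v) f m =
  \tsum_(x0, x1 <- gcoact A x)
    (ayd_rhs v (f * antipode x1) (m ◁ uiota x0)
     - ayd_rhs v (gact A x0 (antipode x1 * f)) m).
Proof.
have tl := ayd_legs_trilin f m.
rewrite {1}/ayd_rhs tsum_comulU_cons; last by lin.
under tsum_eq => v1 v23 do [rewrite tsum_comulU_cons; last by lin].
rewrite /ayd_rhs; under [RHS]tsum_eq => x0 x1 do rewrite -tsumB.
rewrite [RHS]tsum_exchange; apply: tsum_eq => v1 v23.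
under [RHS]tsum_eq => x0 x1 do rewrite -tsumB.
rewrite [RHS]tsum_exchange -tsumD; apply: tsum_eq => v2 v3.
rewrite addrA /ayd_legs.
(* Each Leibniz term carries both terms of the coaction of a product with [x]. Bringing the sum over
   the coaction of [x] innermost reduces the claim to fixed legs. *)
pose E a al b be c ga :=
  left_smash (antipodeU c) (f * antipode (al * be * ga)) a (m ◁ b).
transitivity (\tsum_(a, al <- coactU A v1) \tsum_(b, be <- coactU A v2)
  \tsum_(c, ga <- coactU A v3)
  ((\tsum_(x0, x1 <- gcoact A x) E (uiota x0 * a) (x1 * al) b be c ga
     + E a (gact A x al) b be c ga)
  + (\tsum_(x0, x1 <- gcoact A x) E a al (uiota x0 * b) (x1 * be) c ga
     + E a al b (gact A x be) c ga)
  + (\tsum_(x0, x1 <- gcoact A x) E a al b be (uiota x0 * c) (x1 * ga)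
     + E a al b be c (gact A x ga)))).
  rewrite tsum_coactU_cons //; last by rewrite /left_smash; lin.
  rewrite -!tsumD; apply: tsum_eq => a al.
  rewrite tsum_coactU_cons //; last by rewrite /left_smash; lin.
  rewrite tsum_exchange -!tsumD; apply: tsum_eq => b be.
  rewrite tsum_coactU_cons //; last by rewrite /left_smash; lin.
  rewrite [X in X + _ + _ + _ = _]tsum_exchange.
  by rewrite [X in _ + (X + _) + _ = _]tsum_exchange -!tsumD.
under [RHS]tsum_eq => x0 x1 do rewrite -tsumB.
rewrite [RHS]tsum_exchange; apply: tsum_eq => a al.
under [RHS]tsum_eq => x0 x1 do rewrite -tsumB.
rewrite [RHS]tsum_exchange; apply: tsum_eq => b be.
under [RHS]tsum_eq => x0 x1 do rewrite -tsumB.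
rewrite [RHS]tsum_exchange; apply: tsum_eq => c ga.
exact: pointwise.
Qed.

Lemma tsum_ind_coact_act (Z : lmodType K) (E : M -> F -> Z) x m : bilin E ->
  tsum (ind_coact I (ind_act I x m)) E =
  \tsum_(m0, m1 <- ind_coact I m)
    (\tsum_(x0, x1 <- gcoact A x) E (ind_act I x0 m0) (x1 * m1)
     + E m0 (gact A x m1)).
Proof.
move=> bE; rewrite ind_compat tsum_add // tsumD; congr (_ + _).
  rewrite tsum_tsum // [RHS]tsum_exchange; apply: tsum_eq => x0 x1.
  by rewrite tsum_tsum //; apply: tsum_eq => m0 m1; rewrite tsum_tens.
by rewrite tsum_tsum //; apply: tsum_eq => m0 m1; rewrite tsum_tens.
Qed.

Lemma ayd_rhs1 f m : ayd_rhs 1 f m = (f ⊗ 1) ⊗ m.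
Proof.
have tl := ayd_legs_trilin f m.
rewrite /ayd_rhs comulU1 tsum_tens; last by lin.
rewrite comulU1 tsum_tens; last by lin.
rewrite /ayd_legs !(coactU1 A hX).
rewrite tsum_tens; last by rewrite /left_smash; lin.
rewrite tsum_tens; last by rewrite /left_smash; lin.
rewrite tsum_tens; last by rewrite /left_smash; lin.
rewrite /left_smash antipodeU1 comulU1 tsum_tens; last by lin.
by rewrite !mulr1 antipode1 mulr1 uactF1 twisted_act1.
Qed.

Definition twisted_coact m : (F ⊗ U) ⊗ M :=
  \tsum_(m0, m1 <- ind_coact I m) (sigmaF A * antipode m1 ⊗ 1) ⊗ m0.

Lemma ayd_rhs_coact v m :
  \tsum_(m0, m1 <- ind_coact I m) ayd_rhs v (sigmaF A * antipode m1) m0 =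
  twisted_coact (m ◁ v).
Proof.
have bG := ayd_rhs_bilin.
elim/envalg_ind: v m => [|k u IH|u v IHu IHv|x v IH] m.
- rewrite twisted_act1 // /twisted_coact; apply: tsum_eq => m0 m1.
  exact: ayd_rhs1.
- rewrite (linZ (bact.2 m)) (linZ (_ : linear twisted_coact)); last first.
    by rewrite /twisted_coact; lin.
  rewrite -IH -tsumZ; apply: tsum_eq => m0 m1.
  exact: (linZ (ayd_rhs_linear _ _)).
- rewrite (linD (bact.2 m)) (linD (_ : linear twisted_coact)); last first.
    by rewrite /twisted_coact; lin.
  rewrite -IHu -IHv -tsumD; apply: tsum_eq => m0 m1.
  exact: (linD (ayd_rhs_linear _ _)).
rewrite twisted_actM // -IH twisted_act_gen //.
have bv := bG v.
pose E m f := ayd_rhs v (sigmaF A * antipode f) m.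
have bE : bilin E by rewrite /E; lin.
have [cl _ _] := ind_coact_comod I.
rewrite -[RHS]/(tsum _ E) (linD cl) (linN cl) (linZ cl).
rewrite tsum_add // tsum_opp // tsum_scale // tsum_ind_coact_act //.
rewrite -tsumZ -tsumB; apply: tsum_eq => m0 m1.
rewrite ayd_rhs_cons /E.
have l2 m' : linear (fun f => ayd_rhs v f m') by lin.
have lm f : linear (ayd_rhs v f) by lin.
set S := antipode m1.
rewrite antipode_gact tsumB.
(* Leibniz on (S(x_<1>) sigma) S(m_<1>): the modular identity evaluates the derivative of the first
   factor, and the derivative of the second recombines into S(x |> m_<1>), the last term in the
   compatibility of [M]. *)
have -> : \tsum_(x0, x1 <- gcoact A x)
      ayd_rhs v (gact A x0 (antipode x1 * (sigmaF A * S))) m0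
  = \tsum_(x0, x1 <- gcoact A x)
      ayd_rhs v (\tr (ad_mx X x0) *: (sigmaF A * S * antipode x1)) m0
    - ayd_rhs v (\tr (ad_mx X x) *: (sigmaF A * S)) m0
    + ayd_rhs v (sigmaF A * \tsum_(x0, x1 <- gcoact A x) antipode x1 * gact A x0 S) m0.
  rewrite -!(lin_tsum _ _ (l2 m0)) -(linN (l2 m0)) -!(linD (l2 m0)).
  congr (ayd_rhs v _ m0).
  under tsum_eq => x0 x1 do rewrite mulrA gact_der.
  rewrite tsumD; congr (_ + _).
    rewrite -(lin_tsum _ _ (lin_mull S)) gact_antipode_sigma // mulrBl.
    rewrite -scalerAl (lin_tsum _ _ (lin_mull S)); congr (_ - _).
    apply: tsum_eq => x0 x1; rewrite -scalerAl; congr (_ *: _).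
    by rewrite -mulrA mulrC [antipode x1 * _]mulrC mulrCA.
  rewrite (lin_tsum _ _ (lin_mulr _)); apply: tsum_eq => x0 x1.
  by rewrite -!mulrA mulrCA.
(* The terms with the trace of ad x_<0> cancel the scalar part of m_<0> ◁ x_<0>; its other part is
   minus the first term in the compatibility of [M]. *)
rewrite opprD addrA opprB addrA [X in X - _ = _]addrAC -tsumB.
rewrite (linZ (l2 m0)) opprD addrA; congr (_ - _).
rewrite addrC; congr (_ + _); rewrite -tsumN; apply: tsum_eq => x0 x1.
rewrite twisted_act_gen // (linD (lm _)) (linN (lm _)) (linZ (lm _)) (linZ (l2 _)).
by rewrite addrAC subrr add0r antipodeM -/S -mulrA [S * _]mulrC.
Qed.

End AntiYetterDrinfeld.

(** * The bicrossed product *)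

Section BicrossedOps.
Variables (K : fieldType) (g : lieAlgType K) (X : (\dim {:g}).-tuple g).
Hypothesis hX : basis_of {:g} X.
Variables (F : comHopfAlgType K) (A : gHopfAlgebra X F).
Local Notation U := (envalg g).
Local Notation B := (F ⊗ U)%type.
Local Notation mul := (hmul (bicrossed A)).
Implicit Types (u v s : U) (f h p q : F).

Lemma bicrossed_mul_bilin : bilin mul.
Proof. by rewrite /bicrossed /=; lin. Qed.

Lemma bicrossed_comul_linear : linear (hcomul (bicrossed A)).
Proof. by rewrite /bicrossed /=; lin. Qed.

Lemma bicrossed_antipode_linear : linear (hantipode (bicrossed A)).
Proof. by rewrite /bicrossed /=; lin. Qed.

Lemma bicrossed_mulE f u h v :
  mul (f ⊗ u) (h ⊗ v) = \tsum_(u1, u2 <- comulU u) f * uactF A u1 h ⊗ u2 * v.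
Proof. by rewrite /bicrossed /= !tsum_tens //; lin. Qed.

Lemma tsum_bicrossed_comul (Z : lmodType K) (E : B -> B -> Z) f u : bilin E ->
  tsum (hcomul (bicrossed A) (f ⊗ u)) E =
  \tsum_(f1, f2 <- comul f) \tsum_(u1, u2 <- comulU u)
  \tsum_(a, al <- coactU A u1) E (f1 ⊗ a) (f2 * al ⊗ u2).
Proof.
move=> bE; rewrite /bicrossed /= [X in tsum X E]tsum_tens; last by lin.
rewrite tsum_tsum //; apply: tsum_eq => f1 f2.
rewrite tsum_tsum //; apply: tsum_eq => u1 u2.
by rewrite tsum_tsum //; apply: tsum_eq => a al; rewrite tsum_tens.
Qed.

(** An instance of associativity, from [uactFM] and coassociativity in U(g). As the bicrossed
    antipode begins with a factor [1 ⊗ s], it collects all [F]-components of S(h_(3)) n h_(1) into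
    one product behind that factor. *)
Lemma bicrossed_mul_pull s p q u :
  mul (mul (1 ⊗ s) (p ⊗ 1)) (q ⊗ u) = mul (1 ⊗ s) (p * q ⊗ u).
Proof.
have bm := bicrossed_mul_bilin.
rewrite !bicrossed_mulE (lin_tsum _ _ (bm.1 _)).
under tsum_eq => s1 s2 do rewrite bicrossed_mulE mul1r mulr1.
rewrite -(@tsum_comulU_assoc _ _ _
  (fun a b c => uactF A a p * uactF A b q ⊗ c * u)); last by lin.
apply: tsum_eq => s1 s2; rewrite mul1r uactFM.
by rewrite (lin_tsum _ _ ((tens_bilin _ _).1 _)).
Qed.

Lemma bicrossed_antipode_mul q w p f a :
  mul (mul (hantipode (bicrossed A) (q ⊗ w)) (p ⊗ 1)) (f ⊗ a) =
  \tsum_(c, ga <- coactU A w) \tsum_(s1, s2 <- comulU (antipodeU c))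
    uactF A s1 (antipode (q * ga) * p * f) ⊗ s2 * a.
Proof.
have bm := bicrossed_mul_bilin.
have -> : hantipode (bicrossed A) (q ⊗ w) = \tsum_(c, ga <- coactU A w)
    mul (1 ⊗ antipodeU c) (antipode (q * ga) ⊗ 1).
  by rewrite /bicrossed /= [LHS]tsum_tens //; lin.
rewrite !(lin_tsum _ _ (bm.1 _)); apply: tsum_eq => c ga.
rewrite !bicrossed_mul_pull bicrossed_mulE.
by apply: tsum_eq => s1 s2; rewrite mul1r.
Qed.

Lemma bicrossed_counit_scalar : scalar (hcounit (bicrossed A)).
Proof.
have b : bilin (fun f u => counit (f : F) * counitU (u : U) : K^o) by lin.
exact: tsum_linear b.
Qed.

Lemma bicrossed_counitE f u :
  hcounit (bicrossed A) (f ⊗ u) = counit f * counitU u.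
Proof.
rewrite /bicrossed /= [LHS](@tsum_tens _ _ _ K^o) //.
by lin.
Qed.

End BicrossedOps.

(** * The SAYD axioms *)

Section TwistedModule.
Variables (K : fieldType) (g : lieAlgType K) (X : (\dim {:g}).-tuple g).
Hypothesis hX : basis_of {:g} X.
Variables (F : comHopfAlgType K) (A : gHopfAlgebra X F).
Variables (M : lmodType K) (I : induced_module A M).
Local Notation U := (envalg g).
Local Notation B := (F ⊗ U)%type.
Local Notation sigma := (sigmaF A).
Implicit Types (m : M) (k : B).

Let bact : bilin (twisted_act I) := twisted_act_bilin hX I.

Definition bicrossed_act m k : M := \tsum_(f, u <- k) counit f *: twisted_act I m u.

Lemma bicrossed_act_bilin : bilin bicrossed_act.
Proof. by rewrite /bicrossed_act; lin. Qed.

Lemma bicrossed_actE m f u : bicrossed_act m (f ⊗ u) = counit f *: twisted_act I m u.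
Proof. by rewrite /bicrossed_act tsum_tens //; lin. Qed.

Lemma twisted_coact_linear : linear (twisted_coact I).
Proof. by rewrite /twisted_coact; lin. Qed.

Lemma tsum_twisted_coact (Z : lmodType K) (E : B -> M -> Z) m : bilin E ->
  tsum (twisted_coact I m) E =
  \tsum_(m0, m1 <- ind_coact I m) E (sigma * antipode m1 ⊗ 1) m0.
Proof.
move=> bE; rewrite /twisted_coact tsum_tsum //; apply: tsum_eq => m0 m1.
by rewrite tsum_tens.
Qed.

Lemma counit_sigma_antipode f : counit (sigma * antipode f) = counit f.
Proof. by rewrite counitM (counit_sigma hX) mul1r counit_antipode. Qed.

Lemma bicrossed_right_module : right_module (bicrossed A) bicrossed_act.
Proof.
have ba := bicrossed_act_bilin; have bm := bicrossed_mul_bilin A.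
split=> // [m|m]; first by rewrite bicrossed_actE counit1 twisted_act1 // scale1r.
move=> h k; move: h; apply: lin_tens_ext; [by lin|by lin|move=> f u].
move: k; apply: lin_tens_ext; [by lin|by lin|move=> h v].
rewrite bicrossed_mulE (lin_tsum _ _ (ba.2 m)) !bicrossed_actE.
rewrite (linZ (bact.1 _)) -twisted_actM //.
(* The counit turns the action of [u1] on [h] into the scalar counit(u1) counit(h), so a counit on
   the first leg of [u] is inserted to match. *)
rewrite -(tsum_counitUl u (E := fun u => twisted_act I m (u * v))); last by lin.
rewrite -!tsumZ; apply: tsum_eq => u1 u2.
by rewrite bicrossed_actE counitM counit_uactF !scalerA mulrA mulrC mulrA.
Qed.

(** The antipode reverses the coproduct, turning the right coaction into a left one, and the
    grouplike [sigma] is duplicated on both legs. The U(g)-component is 1, so [coactU] contributes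
    nothing. *)
Lemma bicrossed_left_comodule : left_comodule (bicrossed A) (twisted_coact I).
Proof.
have [cl ca cu] := ind_coact_comod I.
have lc := twisted_coact_linear; have lD := bicrossed_comul_linear hX A.
split=> // m; last first.
  rewrite tsum_twisted_coact; last first.
    by split=> [n|h]; [exact: lin_scalel (bicrossed_counit_scalar A) | lin].
  rewrite -[RHS]cu; apply: tsum_eq => m0 m1.
  by rewrite bicrossed_counitE counitU1 mulr1 counit_sigma_antipode.
rewrite !tsum_twisted_coact; [|by lin|by lin].
pose E (m0 : M) (p q : F) : B ⊗ (B ⊗ M) :=
  (sigma * antipode q ⊗ 1) ⊗ ((sigma * antipode p ⊗ 1) ⊗ m0).
pose E' m0 (t : F ⊗ F) := tsum t (E m0).
have bE m0 : bilin (E m0) by rewrite /E; lin.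
have bE' : bilin E' by rewrite /E' /E; lin.
transitivity (\tsum_(m0, m1 <- ind_coact I m) E' m0 (comul m1)).
  apply: tsum_eq => m0 m1; rewrite tsum_bicrossed_comul //; last by lin.
  rewrite comulM (comul_sigma hX) comul_antipode tsum_tsum; last by lin.
  rewrite tsum_tens; last by lin.
  rewrite !tsum_tsum; [|by lin|by lin].
  rewrite /E' ; apply: tsum_eq => p q.
  rewrite tsum_tens; last by lin.
  rewrite tsum_tens; last by lin.
  rewrite comulU1 tsum_tens; last by lin.
  rewrite (coactU1 A hX) tsum_tens; last by lin.
  by rewrite !mulr1.
transitivity (\tsum_(m0, m1 <- ind_coact I m) tsum (m0 ⊗ comul m1) E').
  by apply: tsum_eq => m0 m1; rewrite tsum_tens.
rewrite -tsum_tsum // -ca tsum_tsum //; apply: tsum_eq => m0 m1.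
rewrite tsum_tsum // /twisted_coact (lin_tsum _ _ ((tens_bilin _ _).2 _)).
by apply: tsum_eq => m00 m01; rewrite tsum_tens // /E' tsum_tens.
Qed.

Lemma bicrossed_anti_yetter_drinfeld :
  anti_yetter_drinfeld (bicrossed A) bicrossed_act (twisted_coact I).
Proof.
have ba := bicrossed_act_bilin; have bm := bicrossed_mul_bilin A.
have lc := twisted_coact_linear; have lD := bicrossed_comul_linear hX A.
have lS := bicrossed_antipode_linear hX A.
move=> m; apply: lin_tens_ext; [by lin|by lin|move=> f v].
pose T (h1 h2 h3 : B) : B ⊗ M := \tsum_(n1, n0 <- twisted_coact I m)
  hmul (bicrossed A) (hmul (bicrossed A) (hantipode (bicrossed A) h3) n1) h1
    ⊗ bicrossed_act n0 h2.
have tT : trilin T by rewrite /T; lin.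
rewrite -[RHS]/(tsum _ (fun h1 h23 => tsum _ (fun h2 h3 => T h1 h2 h3))).
(* The middle leg only acts, so its [F]-component comes out as a counit; counitality later removes
   it from the coproduct of [f2 * al]. *)
have TE f1 a p b q w : T (f1 ⊗ a) (p ⊗ b) (q ⊗ w) =
    counit p *: T (f1 ⊗ a) (1 ⊗ b) (q ⊗ w).
  rewrite /T -tsumZ; apply: tsum_eq => n1 n0.
  by rewrite !bicrossed_actE counit1 scale1r tensZr.
have TE1 f1 a b q w : T (f1 ⊗ a) (1 ⊗ b) (q ⊗ w) =
    \tsum_(m0, m1 <- ind_coact I m) \tsum_(c, ga <- coactU A w)
      left_smash A (antipodeU c) (antipode (q * ga) * (sigma * antipode m1) * f1) a
        (twisted_act I m0 b).
  rewrite /T tsum_twisted_coact; last by lin.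
  apply: tsum_eq => m0 m1.
  rewrite bicrossed_antipode_mul // bicrossed_actE counit1 scale1r.
  by rewrite !(lin_tsum _ _ ((tens_bilin _ _).1 _)); apply: tsum_eq => c ga;
     rewrite !(lin_tsum _ _ ((tens_bilin _ _).1 _)).
rewrite tsum_bicrossed_comul //; last by lin.
(* Here [f] occurs only as f_(1) S(f_(2)), which sums to its counit, the scalar by which it acts on
   the left side. *)
transitivity (\tsum_(f1, f2 <- comul f) \tsum_(m0, m1 <- ind_coact I m)
  \tsum_(v1, v23 <- comulU v) \tsum_(v2, v3 <- comulU v23)
    ayd_legs I (f1 * antipode f2 * (sigma * antipode m1)) m0 v1 v2 v3).
  have bG w := ayd_rhs_bilin hX I w.
  rewrite bicrossed_actE (linZ lc) -ayd_rhs_coact // -tsumZ.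
  rewrite tsum_exchange; apply: tsum_eq => m0 m1.
  have lG : linear (fun f => ayd_rhs I v (f * (sigma * antipode m1)) m0).
    by have := bG v; lin.
  rewrite -[RHS](lin_tsum _ _ lG) antipoder -scalerAl mul1r.
  by rewrite (linZ ((bG v).1 m0)).
apply: tsum_eq => f1 f2.
rewrite tsum_exchange; apply: tsum_eq => v1 v23.
rewrite tsum_exchange.
transitivity (\tsum_(a, al <- coactU A v1) \tsum_(v2, v3 <- comulU v23)
    \tsum_(b, be <- coactU A v2) T (f1 ⊗ a) (1 ⊗ b) (f2 * al * be ⊗ v3)); last first.
  apply: tsum_eq => a al; rewrite tsum_bicrossed_comul //; last by lin.
  rewrite [RHS]tsum_exchange; apply: tsum_eq => v2 v3.
  rewrite [RHS]tsum_exchange; apply: tsum_eq => b be.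
  rewrite -[LHS](tsum_counitl (f2 * al)
    (E := fun q => T (f1 ⊗ a) (1 ⊗ b) (q * be ⊗ v3))); last by lin.
  by apply: tsum_eq => p q; rewrite [RHS]TE.
rewrite [RHS]tsum_exchange; apply: tsum_eq => v2 v3.
rewrite /ayd_legs tsum_exchange; apply: tsum_eq => a al.
rewrite tsum_exchange; apply: tsum_eq => b be.
rewrite TE1; apply: tsum_eq => m0 m1; apply: tsum_eq => c ga.
congr (left_smash A _ _ _ _).
rewrite -!mulrA [antipode (f2 * _)]antipodeM mulrCA -[RHS]mulrA; congr (_ * _).
by rewrite mulrC !mulrA; congr (_ * _); rewrite mulrC mulrA.
Qed.

Lemma bicrossed_stable : stable bicrossed_act (twisted_coact I).
Proof.
have ba := bicrossed_act_bilin; have [_ _ cu] := ind_coact_comod I.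
move=> m; rewrite tsum_twisted_coact; last by lin.
rewrite -[RHS]cu; apply: tsum_eq => m0 m1.
by rewrite bicrossed_actE counit_sigma_antipode twisted_act1.
Qed.

End TwistedModule.

Theorem theorem3p5 (R : realType) (g : lieAlgType R[i])
    (X : (\dim {:g}).-tuple g) (hX : basis_of {:g} X)
    (F : comHopfAlgType R[i]) (A : gHopfAlgebra X F)
    (M : lmodType R[i]) (I : induced_module A M) :
  is_SAYD (bicrossed A)
    (fun (m : M) (h : F ⊗ envalg g) =>
       \tsum_(f, u <- h) \tsum_(u1, u2 <- comulU u)
         counit f *: (delta_g X u1 *: uact (ind_act I) (antipodeU u2) m))
    (fun m : M =>
       \tsum_(m0, m1 <- ind_coact I m)
         ((sigmaF A * antipode m1 ⊗ 1) ⊗ m0)).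
Proof.
set act := fun _ _ => _; have -> : act = bicrossed_act I.
  by apply/funext => m; apply/funext => h; apply: tsum_eq => f u; rewrite tsumZ.
rewrite -/(twisted_coact I); split.
- exact: bicrossed_right_module.
- exact: bicrossed_left_comodule.
- exact: bicrossed_anti_yetter_drinfeld.
- exact: bicrossed_stable.
Qed.
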